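(* For any $T<1$ and any $0\le t_1<t_2\le T$, we have $$|v(t_2,x)-v(t_1,x)|\le\frac{c_2\,e^{|x|}}{2\sqrt{1-T}}\,(t_2-t_1),\qquad\text{for }x\in\mathbb{R},$$ where $c_2:=\mathsf{E}[S_1e^{S_1}]$ and $S_1:=\sup_{0\le s\le1}|W_s|$. Moreover, $$\lim_{t\to1}v(t,x)=e^x\quad\text{for }x\ge0,\qquad\qquad\liminf_{t\to1}v(t,x)\ge1>e^x\quad\text{for }x<0.$$
   Context: Let $(\Omega,\mathcal{F},(\mathcal{F}_t)_{t\ge 0},\mathsf{P})$ be a complete filtered probability space carrying a standard one-dimensional Brownian motion $W=(W_t)_{t\ge0}$, where $(\mathcal{F}_t)$ is the filtration generated by $W$ augmented with $\mathsf{P}$-null sets. For $t\in[0,1)$ and $x\in\mathbb{R}$, let $X^{t,x}=(X^{t,x}_s)_{s\in[t,1]}$ be the Brownian bridge started at $x$ at time $t$ and pinned at $0$ at time $1$: $$X^{t,x}_s=(1-s)\Big(\frac{x}{1-t}+\int_t^s\frac{\mathrm{d}W_u}{1-u}\Big),\quad s\in[t,1),\qquad X^{t,x}_1=0,$$ i.e. the strong solution of $\mathrm{d}X_s=-\frac{X_s}{1-s}\,\mathrm{d}s+\mathrm{d}W_s$, $s\in[t,1)$, $X_t=x$. Write $\mathsf{E}_{t,x}[\,\cdot\,]=\mathsf{E}[\,\cdot\,|X_t=x]$. The value function is $$v(t,x)=\sup_{0\le\tau\le1-t}\mathsf{E}_{t,x}\big[e^{X_{t+\tau}}\big],\qquad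 (t,x)\in[0,1]\times\mathbb{R},$$ where the supremum is over random times $\tau\in[0,1-t]$ such that $t+\tau$ is an $(\mathcal{F}_s)_{s\ge t}$-stopping time; in particular $v(1,x)=e^x$. Limits as $t\to1$ are taken along $t<1$. *)

(* Defs.v *)
From mathcomp Require Export all_boot all_order all_algebra.
From mathcomp Require Export all_classical all_reals all_analysis.

Set Implicit Arguments.
Unset Strict Implicit.
Unset Printing Implicit Defensive.

Export Order.TTheory GRing.Theory Num.Theory numFieldNormedType.Exports.

Local Open Scope classical_set_scope.
Local Open Scope ring_scope.

(* Time is indexed by R; only nonnegative times are meaningful. *)

Definition natural_filtration (R : realType) (d : measure_display)
    (Omega : measurableType d) (P : probability Omega R)
    (W : R -> {RV P >-> R}) (t : R) : set (set Omega) :=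
  <<s [set A | exists (s : R) (B : set R), [/\ 0 <= s, s <= t, measurable B &
    A = W s @^-1` B]] >>.

Definition augmented_filtration (R : realType) (d : measure_display)
    (Omega : measurableType d) (P : probability Omega R)
    (W : R -> {RV P >-> R}) (t : R) : set (set Omega) :=
  <<s natural_filtration W t `|` [set N | P.-negligible N] >>.

(* The second argument of normal_prob is the standard deviation. *)
Record standard_brownian_motion (R : realType) (d : measure_display)
    (Omega : measurableType d) (P : probability Omega R)
    (W : R -> {RV P >-> R}) : Prop := StandardBrownianMotion {
  sbm_start : {ae P, forall w, W 0 w = 0};
  sbm_gaussian : forall s t : R, 0 <= s -> s < t ->
    forall B : set R, measurable B ->
      P [set w | B (W t w - W s w)] = normal_prob 0 (Num.sqrt (t - s)) B;
  sbm_independent : forall s t : R, 0 <= s -> s < t ->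
    forall A : set Omega, natural_filtration W s A ->
    forall B : set R, measurable B ->
      P (A `&` [set w | B (W t w - W s w)]) =
      (P A * P [set w | B (W t w - W s w)%R])%E;
  sbm_continuous :
    {ae P, forall w, {within `[0, +oo[, continuous (fun t => W t w)}} }.

(* Strong solution on [t, 1) of dX_s = - X_s / (1 - s) ds + dW_s, X_t = x,
   extended by X_1 = 0.  The noise is additive, so the integral form of the
   equation involves only the pathwise Lebesgue integral of the drift. *)
Record brownian_bridge (R : realType) (d : measure_display)
    (Omega : measurableType d) (P : probability Omega R)
    (W : R -> {RV P >-> R}) (t x : R) (X : R -> Omega -> R) : Prop :=
  BrownianBridge {
  bb_adapted : forall s : R, t <= s -> s <= 1 ->
    forall B : set R, measurable B -> augmented_filtration W s (X s @^-1` B);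
  bb_continuous :
    {ae P, forall w, {within `[t, 1[, continuous (fun s => X s w)}};
  bb_sde : {ae P, forall w, forall s : R, t <= s -> s < 1 ->
    X s w = x - (\int[lebesgue_measure]_(u in `[t, s]) (X u w / (1 - u)))
              + (W s w - W t w)};
  bb_end : forall w, X 1 w = 0 }.

Definition admissible_time (R : realType) (d : measure_display)
    (Omega : measurableType d) (P : probability Omega R)
    (W : R -> {RV P >-> R}) (t : R) (tau : Omega -> R) : Prop :=
  (forall w, 0 <= tau w <= 1 - t) /\
  (forall s : R, t <= s -> augmented_filtration W s [set w | t + tau w <= s]).

(* [X t x] is the bridge started at x at time t, for t < 1; at t = 1 there is
   no bridge and the value is exp x by convention. *)
Definition value_function (R : realType) (d : measure_display)
    (Omega : measurableType d) (P : probability Omega R)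
    (W : R -> {RV P >-> R}) (X : R -> R -> R -> Omega -> R) (t x : R)
    : \bar R :=
  if t < 1 then
    ereal_sup [set ('E_P[fun w => expR (X t x (t + tau w)%R w)])%E |
                 tau in [set tau | admissible_time W t tau]]
  else (expR x)%:E.

(* The real supremum is meaningful on almost every path, namely on the
   continuous ones. *)
Definition running_sup (R : realType) (d : measure_display)
    (Omega : measurableType d) (P : probability Omega R)
    (W : R -> {RV P >-> R}) (w : Omega) : R :=
  sup [set `|W s w| | s in `[0, 1]].

Definition c2 (R : realType) (d : measure_display)
    (Omega : measurableType d) (P : probability Omega R)
    (W : R -> {RV P >-> R}) : \bar R :=
  ('E_P[fun w => (running_sup W w * expR (running_sup W w))%R])%E.

(* Main.v *)
Require Import Defs.
From HB Require Import structures.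
From mathcomp Require Import measurable_realfun ring lra.

Set Implicit Arguments.
Unset Strict Implicit.
Unset Printing Implicit Defensive.

Local Open Scope classical_set_scope.
Local Open Scope ring_scope.

(** The idea. Put [sig = sqrt (1 - t)] and run the bridge on the clock
    [r = (s - t) / (1 - t)] of [0, 1]. Then [X_s = (1 - r) x + sig Z_r], where
    [Z] is a Gaussian Markov process whose transitions depend neither on [t]
    nor on [x]: it is the standard bridge. So [v t x] is the value [u sig x] of
    stopping [exp ((1 - r) x + sig Z_r)] for one fixed process, and only [sig]
    varies. For [sig, sig' <= 1] the rewards differ by at most
    [exp |x| |sig - sig'| |Z_r| exp |Z_r|], hence
      [|u sig x - u sig' x| <= exp |x| |sig - sig'| E (M exp M)]
    with [M = sup |Z|]. The three claims follow: the supremum [M] of the bridge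
    is dominated by that of Brownian motion, so the expectation is at most
    [c2]; [|sqrt (1 - t1) - sqrt (1 - t2)| <= (t2 - t1) / (2 sqrt (1 - T))]; and
    letting [sig] tend to 0 in [u sig x <= u 0 x + exp |x| sig c2] gives the
    limit for [x >= 0], since then [u 0 x = exp x]. For [x < 0], waiting until
    time 1 yields the reward 1.

    That [v t x] depends on the law of the bridge only is the delicate point,
    because the stopping times refer to the Brownian filtration, which changes
    with [t]. It is obtained by dynamic programming. On a grid of [n.+1] steps
    the normalised bridge is a Gaussian chain (bridge_chainP), and the best
    reward over grid-valued stopping times is computed by backward induction
    with Gaussian integrals alone (integral_reward_le and optimal_stopping).
    This number, [grid_value n sig x], depends on [n], [sig] and [x] only. By
    Fatou's lemma the grids exhaust the problem, and [v t x] is the supremum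
    over [n] of [grid_value n sig x] (value_function_grid).

    The transition law of the bridge (bridge_increment_law) comes from its
    equation: [X_s / (1 - s)] has increments that are almost sure limits of
    Riemann sums of [dW / (1 - u)], each of which is independent of the past
    with a prescribed Gaussian law.

    The Lipschitz estimate is proved inside the backward induction
    (bellman_lipschitz), together with the comparison of the maxima of the
    bridge and of the walk (emax_compare), which rests on the convexity and the
    evenness of the functions at hand, and with a form of Doob's inequality
    (emax_doob) which makes [c2] finite. *)

(** * Gaussian integrals *)

Section ImageMeasure.
Context {d1 d2 : measure_display} {T1 : measurableType d1}
  {T2 : measurableType d2} {R : realType}.

Definition image_measure (m : {measure set T1 -> \bar R}) (f : T1 -> T2)
    (mf : measurable_fun setT f) : {measure set T2 -> \bar R} :=
  measure_function_pushforward__canonical__measure_function_Measure m mf.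

Lemma image_measureE m f mf A : @image_measure m f mf A = m (f @^-1` A).
Proof. by []. Qed.

Lemma integral_image_measure m f mf (h : T2 -> \bar R) :
  measurable_fun setT h -> (forall y, 0 <= h y)%E ->
  (\int[@image_measure m f mf]_y h y = \int[m]_x h (f x))%E.
Proof. by move=> mh h0; rewrite ge0_integral_pushforward. Qed.

End ImageMeasure.

Lemma integral_probability_cst {R : realType} {d : measure_display}
  {T : measurableType d} (P : probability T R) (c : \bar R) : (\int[P]__ c = c)%E.
Proof.
have -> : (\int[P]__ c = \int[P]_x cst c x)%E by [].
rewrite integral_cst// -[RHS]mule1; congr (_ * _)%E.
exact: (@probability_setT _ _ _ P).
Qed.

Section GaussianMeasure.
Context {R : realType}.
Local Notation mu := (@lebesgue_measure R).
Local Notation gauss := (normal_prob (0:R) 1).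
Implicit Types (f : R -> \bar R) (c : R).

Lemma measurable_scale c :
  measurable_fun setT (fun y : R => c * y : measurableTypeR R).
Proof. exact: measurable_funM. Qed.

(** Scaling is checked on intervals, which determine Lebesgue measure. *)
Lemma lebesgue_measure_scale c (c0 : 0 < c) (A : set R) : measurable A ->
  mu A = mscale (NngNum (ltW c0)) (image_measure mu (measurable_scale c)) A.
Proof.
move: A; apply: lebesgue_measure_unique => ? [[a b]] _ <-.
have E : (fun y : R => c * y) @^-1` `]a, b] = `]c^-1 * a, c^-1 * b]%classic.
  apply/seteqP; split => y /=; rewrite !in_itv /= ![c^-1 * _]mulrC;
    by rewrite ltr_pdivrMr// ler_pdivlMr// mulrC.
transitivity (c%:E * mu ((fun y : R => (c * y)%R) @^-1` `]a, b]))%E; last by [].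
rewrite E !lebesgue_measure_itv /= !lte_fin ltr_pM2l ?invr_gt0//.
case: ifPn => _; last by rewrite mule0.
by rewrite -!EFinB -EFinM -mulrBr mulrA divff ?mul1r ?gt_eqF.
Qed.

Lemma integral_lebesgue_scale c f : 0 < c -> measurable_fun setT f ->
  (forall y, 0 <= f y)%E ->
  (\int[mu]_y f y = c%:E * \int[mu]_y f (c * y)%R)%E.
Proof.
move=> c0 mf f0.
transitivity (\int[mscale (NngNum (ltW c0))
   (image_measure mu (measurable_scale c))]_y f y)%E.
  by apply: eq_measure_integral => A mA _; exact: lebesgue_measure_scale.
by rewrite ge0_integral_mscale// integral_image_measure.
Qed.

Lemma integral_lebesgue_opp f : measurable_fun setT f ->
  (forall y, 0 <= f y)%E -> (\int[mu]_y f y = \int[mu]_y f (- y)%R)%E.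
Proof.
move=> mf f0.
have mN : measurable_fun setT ((-%R) : R -> measurableTypeR R).
  exact: oppr_measurable.
rewrite -(integral_image_measure mu mN)//.
by apply: eq_measure_integral => A mA _; rewrite [RHS]lebesgue_measureN.
Qed.

(** The density is a Radon-Nikodym derivative, by uniqueness of the latter. *)
Lemma integral_normal_prob m s f : measurable_fun setT f ->
  (forall y, 0 <= f y)%E ->
  (\int[normal_prob m s]_y f y = \int[mu]_y (f y * (normal_pdf m s y)%:E))%E.
Proof.
move=> mf f0; have dom := @normal_prob_dominates R m s.
rewrite -(Radon_Nikodym_SigmaFinite.change_of_variables dom)//=.
have iRN := Radon_Nikodym_SigmaFinite.f_integrable dom.
apply: ge0_ae_eq_integral => //.
- by apply: emeasurable_funM => //; exact: (measurable_int mu).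
- by apply: emeasurable_funM => //; apply/measurable_EFinP;
    exact: measurable_normal_pdf.
- move=> x _; rewrite mule_ge0//; exact: Radon_Nikodym_SigmaFinite.f_ge0.
- by move=> x _; rewrite mule_ge0// lee_fin normal_pdf_ge0.
apply: ae_eqe_mul2l; apply: integral_ae_eq => //.
- by apply/measurable_EFinP; exact: measurable_normal_pdf.
- by move=> E _ mE; rewrite -Radon_Nikodym_SigmaFinite.f_integral.
Qed.

Lemma normal_pdf_scale c y : 0 < c ->
  c * normal_pdf 0 c (c * y) = normal_pdf 0 1 y :> R.
Proof.
move=> c0; rewrite !normal_pdfE ?oner_eq0 ?gt_eqF// mulrA; congr (_ * _).
  rewrite /normal_peak expr1n mul1r -mulrnAr sqrtrM ?sqr_ge0//.
  by rewrite sqrtr_sqr gtr0_norm// invfM mulrA divff ?mul1r// gt_eqF.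
rewrite /normal_fun !subr0 expr1n; congr expR.
by field; rewrite gt_eqF.
Qed.

Lemma integral_gauss_scale c f : 0 < c -> measurable_fun setT f ->
  (forall y, 0 <= f y)%E ->
  (\int[normal_prob 0 c]_y f y = \int[gauss]_y f (c * y)%R)%E.
Proof.
move=> c0 mf f0; have mc := measurable_scale c.
have mfc : measurable_fun setT (fun y => f (c * y)) by exact: (measurableT_comp mf mc).
rewrite (integral_normal_prob 0 c mf f0) (integral_normal_prob 0 1 mfc (fun y => f0 _)).
have mp s : measurable_fun setT (fun y : R => (normal_pdf 0 s y)%:E).
  by apply/measurable_EFinP; exact: measurable_normal_pdf.
rewrite (integral_lebesgue_scale c0); last 2 first.
- exact: emeasurable_funM.
- by move=> y; rewrite mule_ge0// lee_fin normal_pdf_ge0.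
rewrite -ge0_integralZl//.
- apply: eq_integral => y _.
  by rewrite muleCA -EFinM normal_pdf_scale.
- apply: emeasurable_funM; first exact: measurableT_comp.
  by apply: (measurableT_comp (mp c)).
- by move=> y _; rewrite mule_ge0// lee_fin normal_pdf_ge0.
- by rewrite lee_fin ltW.
Qed.

Lemma normal_prob_scale c (B : set R) : 0 < c -> measurable B ->
  normal_prob 0 c B = gauss [set y | B (c * y)].
Proof.
move=> c0 mB.
have mB' : measurable [set y | B (c * y)].
  by rewrite -[X in measurable X]setTI; exact: measurable_scale.
have mi : measurable_fun setT (EFin \o (\1_B : R -> R)).
  by apply/measurable_EFinP; exact: measurable_indic.
have i0 y : (0 <= (\1_B y)%:E :> \bar R)%E by rewrite lee_fin.
transitivity (\int[normal_prob 0 c]_y (\1_B y)%:E)%E.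
  by rewrite integral_indic// setIT.
transitivity (\int[gauss]_y (\1_[set y | B (c * y)] y)%:E)%E.
  exact: (integral_gauss_scale c0 mi i0).
by rewrite integral_indic// setIT.
Qed.

Lemma integral_gauss_opp f : measurable_fun setT f ->
  (forall y, 0 <= f y)%E ->
  (\int[gauss]_y f y = \int[gauss]_y f (- y)%R)%E.
Proof.
move=> mf f0; rewrite !integral_normal_prob//; last first.
  by apply: measurableT_comp => //; exact: oppr_measurable.
rewrite integral_lebesgue_opp.
- apply: eq_integral => y _; rewrite !normal_pdfE ?oner_eq0//.
  by rewrite /normal_fun !subr0 sqrrN.
- apply: emeasurable_funM => //.
  by apply/measurable_EFinP; exact: measurable_normal_pdf.
- by move=> y; rewrite mule_ge0// lee_fin normal_pdf_ge0.
Qed.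

(** Completing the square: [exp (c y)] times the standard density is
    [exp (c^2 / 2)] times the density centred at [c]. *)
Lemma integral_gauss_expR c :
  (\int[gauss]_y (expR (c * y))%:E = (expR (c ^+ 2 / 2))%:E)%E.
Proof.
rewrite integral_normal_prob.
- transitivity (\int[mu]_y ((expR (c ^+ 2 / 2))%:E * (normal_pdf c 1 y)%:E))%E.
    apply: eq_integral => y _; rewrite -!EFinM !normal_pdfE ?oner_eq0//.
    congr EFin; rewrite !(mulrCA _ (normal_peak 1)); congr (_ * _).
    rewrite /normal_fun -!expRD; congr expR; rewrite expr1n subr0; by field.
  rewrite ge0_integralZl//.
  + by rewrite integral_normal_pdf mule1.
  + by apply/measurable_EFinP; exact: measurable_normal_pdf.
  + by move=> y _; rewrite lee_fin normal_pdf_ge0.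
- apply/measurable_EFinP; apply: measurableT_comp => //.
- by move=> y; rewrite lee_fin expR_ge0.
Qed.

End GaussianMeasure.

(** * Dynamic programming for Gaussian chains *)

Section ChainFunctionals.
Context {R : realType}.
Local Notation gauss := (normal_prob (0:R) 1).
Implicit Types (h : R -> \bar R) (a b : nat -> R) (g : nat -> R -> R).

(** The transition operator of a Gaussian step. Position and dispersion are
    separate arguments because the comparison of chains varies each of them. *)
Definition gstep h (u v : R) : \bar R := (\int[gauss]_y h (u + v * y)%R)%E.

(** The function whose mean at the running supremum is [c2]. *)
Definition xexp (m : R) : R := m * expR m.

(** Backward induction for the chain [z_{k+1} = a k * z_k + b k * xi], at step
    [k] with [j] steps left before the last grid point [k + j]. After that point
    there remains the terminal time, where the reward is [1]. *)
Fixpoint bellman a b g (j k : nat) (z : R) : \bar R :=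
  match j with
  | 0%N => maxe (g k z)%:E 1%E
  | j'.+1 => maxe (g k z)%:E (gstep (bellman a b g j' k.+1) (a k * z) (b k))
  end.

(** The mean of [xexp] at the running maximum of [|z|] over the [j] steps to
    come, [m] being the maximum reached so far. *)
Fixpoint emax a b (j k : nat) (m z : R) : \bar R :=
  match j with
  | 0%N => (xexp (Num.max m `|z|))%:E
  | j'.+1 => gstep (emax a b j' k.+1 (Num.max m `|z|)) (a k * z) (b k)
  end.

Lemma measurable_affine (u v : R) : measurable_fun setT (fun y : R => u + v * y).
Proof. by apply: measurable_funD => //; exact: measurable_funM. Qed.

Lemma gstep_ge0 h u v : (forall z, 0 <= h z)%E -> (0 <= gstep h u v)%E.
Proof. by move=> h0; apply: integral_ge0 => y _. Qed.

(** Measurability in a parameter that enters both the integrand and the step: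
    the form in which Tonelli's theorem is used in the backward inductions. *)
Lemma measurable_gstep_param d (T : measurableType d) (h : T * R -> \bar R)
    (u v : T -> R) : measurable_fun setT h -> (forall p, 0 <= h p)%E ->
  measurable_fun setT u -> measurable_fun setT v ->
  measurable_fun setT (fun t => gstep (fun z => h (t, z)) (u t) (v t)).
Proof.
move=> mh h0 mu mv.
apply: (measurable_fun_fubini_tonelli_F (m2 := gauss)
  (fun p : T * R => h (p.1, u p.1 + v p.1 * p.2))) => //.
apply: (measurableT_comp mh); apply: measurable_fun_pair => //=.
apply: measurable_funD; first exact: measurableT_comp.
by apply: measurable_funM => //; exact: measurableT_comp.
Qed.

Lemma gstep_le h1 h2 u v : measurable_fun setT h1 -> measurable_fun setT h2 ->
  (forall z, 0 <= h1 z)%E -> (forall z, h1 z <= h2 z)%E ->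
  (gstep h1 u v <= gstep h2 u v)%E.
Proof.
move=> m1 m2 h10 h12; apply: ge0_le_integral => //.
- exact: (measurableT_comp m1 (measurable_affine u v)).
- exact: (measurableT_comp m2 (measurable_affine u v)).
Qed.

Lemma gstep_cst c u v : gstep (fun=> c) u v = c.
Proof.
exact: (integral_probability_cst (normal_prob 0 1) c).
Qed.

Lemma gstepD h1 h2 u v : measurable_fun setT h1 -> measurable_fun setT h2 ->
  (forall z, 0 <= h1 z)%E -> (forall z, 0 <= h2 z)%E ->
  (gstep (fun z => h1 z + h2 z) u v = gstep h1 u v + gstep h2 u v)%E.
Proof.
move=> m1 m2 h10 h20; rewrite /gstep ge0_integralD//.
- exact: (measurableT_comp m1 (measurable_affine u v)).
- exact: (measurableT_comp m2 (measurable_affine u v)).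
Qed.

Lemma gstepZ h (c : R) u v : measurable_fun setT h -> (forall z, 0 <= h z)%E ->
  0 <= c -> (gstep (fun z => c%:E * h z) u v = c%:E * gstep h u v)%E.
Proof.
move=> mh h0 c0; rewrite /gstep ge0_integralZl//.
exact: (measurableT_comp mh (measurable_affine u v)).
Qed.

Lemma gstep_opp h u v : measurable_fun setT h -> (forall z, 0 <= h z)%E ->
  gstep h u (- v) = gstep h u v.
Proof.
move=> mh h0; rewrite /gstep [RHS]integral_gauss_opp//.
- by apply: eq_integral => y _; rewrite mulrN mulNr.
- exact: (measurableT_comp mh (measurable_affine u v)).
Qed.

Lemma gstep_expR c u v :
  gstep (fun z => (expR (c * z))%:E) u v =
  (expR (c * u) * expR ((c * v) ^+ 2 / 2))%:E.
Proof.
rewrite /gstep EFinM -(integral_gauss_expR (c * v)) -ge0_integralZl//.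
- by apply: eq_integral => y _; rewrite -EFinM -expRD mulrDr mulrA.
- by apply/measurable_EFinP; apply: measurableT_comp.
Qed.

Lemma xexp_ge0 m : 0 <= m -> 0 <= xexp m.
Proof. by move=> m0; rewrite mulr_ge0// expR_ge0. Qed.

Lemma xexp_le m m' : 0 <= m -> m <= m' -> xexp m <= xexp m'.
Proof. by move=> m0 mm; rewrite ler_pM// ?expR_ge0// ler_expR. Qed.

Lemma measurable_xexp : measurable_fun setT xexp.
Proof. by apply: measurable_funM. Qed.

(** With [exp] convex, what remains is
    [l (1 - l) (m1 - m2) (exp m1 - exp m2) >= 0]. *)
Lemma xexp_convex (l m1 m2 : R) : 0 <= l <= 1 -> 0 <= m1 -> 0 <= m2 ->
  xexp (l * m1 + (1 - l) * m2) <= l * xexp m1 + (1 - l) * xexp m2.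
Proof.
move=> /andP[l0 l1] m10 m20; rewrite /xexp.
have l'0 : 0 <= 1 - l by rewrite subr_ge0.
have cvx : expR (l * m1 + (1 - l) * m2) <= l * expR m1 + (1 - l) * expR m2.
  set c := l * m1 + _.
  (* the graph of exp lies above its tangent at the barycentre *)
  have tangent m : expR c * (1 + (m - c)) <= expR m.
    have -> : expR m = expR c * expR (m - c) by rewrite -expRD addrC subrK.
    by rewrite ler_wpM2l ?expR_ge0// expR_ge1Dx.
  have := lerD (ler_wpM2l l0 (tangent m1)) (ler_wpM2l l'0 (tangent m2)).
  apply: le_trans; rewrite le_eqVlt; apply/orP; left; apply/eqP.
  by rewrite /c; ring.
apply: (@le_trans _ _ ((l * m1 + (1 - l) * m2) *
    (l * expR m1 + (1 - l) * expR m2))).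
  by rewrite ler_wpM2l// addr_ge0// mulr_ge0.
have cross : 0 <= (m1 - m2) * (expR m1 - expR m2).
  case: (leP m1 m2) => m12.
    by rewrite mulr_le0// subr_le0// ler_expR.
  by rewrite mulr_ge0// subr_ge0 ?ler_expR ltW.
have : 0 <= l * (1 - l) * ((m1 - m2) * (expR m1 - expR m2)).
  by rewrite mulr_ge0// mulr_ge0.
by move: (expR m1) (expR m2) => e1 e2; lra.
Qed.

Lemma maxabs_ge0 (m z : R) : 0 <= Num.max m `|z|.
Proof. by rewrite le_max normr_ge0 orbT. Qed.

Lemma maxabs_le (m m' z : R) : m <= m' -> Num.max m `|z| <= Num.max m' `|z|.
Proof. by move=> mm; rewrite ge_max !le_max mm lexx orbT. Qed.

Lemma emax_ge0 a b j k m z : (0 <= emax a b j k m z)%E.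
Proof.
elim: j k m z => [|j IH] k m z /=; first by rewrite lee_fin xexp_ge0// maxabs_ge0.
exact: gstep_ge0.
Qed.

Lemma bellman_ge0 a b g j k z : (0 <= bellman a b g j k z)%E.
Proof.
elim: j k z => [|j IH] k z /=; rewrite le_max ?lee01 ?orbT//.
by rewrite gstep_ge0 ?orbT.
Qed.

Lemma measurable_maxabs d (T : measurableType d) (u v : T -> R) :
  measurable_fun setT u -> measurable_fun setT v ->
  measurable_fun setT (fun t => Num.max (u t) `|v t|).
Proof.
by move=> mu mv; apply: measurable_maxr => //; exact: measurableT_comp.
Qed.

Lemma measurable_emax_param a b j k d (T : measurableType d) (u v : T -> R) :
  measurable_fun setT u -> measurable_fun setT v ->
  measurable_fun setT (fun t => emax a b j k (u t) (v t)).
Proof.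
elim: j k d T u v => [|j IH] k d T u v mu mv /=.
  apply/measurable_EFinP; apply: (measurableT_comp measurable_xexp).
  exact: measurable_maxabs.
have := @measurable_gstep_param _ T (fun p => emax a b j k.+1
  (Num.max (u p.1) `|v p.1|) p.2) (fun t => a k * v t) (fun=> b k).
apply => //; last exact: measurable_funM.
  by apply: IH => //; apply: measurable_maxabs; exact: measurableT_comp.
by move=> p; exact: emax_ge0.
Qed.

Lemma measurable_emax a b j k m : measurable_fun setT (emax a b j k m).
Proof. exact: measurable_emax_param. Qed.

Lemma measurable_bellman a b g j k : (forall k, measurable_fun setT (g k)) ->
  measurable_fun setT (bellman a b g j k).
Proof.
move=> mg; elim: j k => [|j IH] k /=.
  by apply: measurable_maxe => //; exact/measurable_EFinP.
apply: measurable_maxe; first exact/measurable_EFinP.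
have := @measurable_gstep_param _ R (fun p => bellman a b g j k.+1 p.2)
  (fun z => a k * z) (fun=> b k).
apply => //; last exact: measurable_funM.
  by move: (IH k.+1) => /measurableT_comp; apply.
by move=> p; exact: bellman_ge0.
Qed.

Lemma emax_homo a b j k m m' z : m <= m' ->
  (emax a b j k m z <= emax a b j k m' z)%E.
Proof.
elim: j k m m' z => [|j IH] k m m' z mm /=.
  by rewrite lee_fin xexp_le ?maxabs_ge0// maxabs_le.
apply: gstep_le => [|||y]; rewrite ?emax_ge0//; do 1?exact: measurable_emax.
  by move=> y; exact: emax_ge0.
by apply: IH; exact: maxabs_le.
Qed.

Lemma emax_ge_xexp a b j k m z : ((xexp (Num.max m `|z|))%:E <= emax a b j k m z)%E.
Proof.
elim: j k m z => [|j IH] k m z //=.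
rewrite -[leLHS](gstep_cst _ (a k * z) (b k)).
apply: gstep_le => //; first exact: measurable_emax.
  by move=> y; rewrite lee_fin xexp_ge0// maxabs_ge0.
move=> y; apply: (le_trans _ (IH _ _ _)).
by rewrite lee_fin xexp_le ?maxabs_ge0// le_max lexx.
Qed.

(** A discrepancy of the rewards is incurred at a single place, where [|z|] is at
    most the running maximum. This is why it goes through the backward induction
    as a multiple of [emax]. *)
Lemma bellman_lipschitz a b g1 g2 (C : R) j k z : 0 <= C ->
  (forall k, measurable_fun setT (g1 k)) ->
  (forall k, measurable_fun setT (g2 k)) ->
  (forall i y, (i <= k + j)%N -> g1 i y <= g2 i y + C * xexp `|y|) ->
  (bellman a b g1 j k z <= bellman a b g2 j k z + C%:E * emax a b j k 0 z)%E.
Proof.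
move=> C0 mg1 mg2.
have reward j' k' y : g1 k' y <= g2 k' y + C * xexp `|y| ->
    ((g1 k' y)%:E <= (g2 k' y)%:E + C%:E * emax a b j' k' 0 y)%E.
  move=> g12; apply: (@le_trans _ _ (g2 k' y + C * xexp `|y|)%:E).
    by rewrite lee_fin.
  rewrite EFinD EFinM leeD2l// lee_wpmul2l ?lee_fin//.
  apply: le_trans (emax_ge_xexp _ _ _ _ _ _).
  by rewrite lee_fin xexp_le// le_max lexx orbT.
have Cemax0 j' k' y : (0 <= C%:E * emax a b j' k' 0 y)%E.
  by rewrite mule_ge0 ?emax_ge0// lee_fin.
elim: j k z => [|j IH] k z g12.
  have := reward 0%N k z (g12 _ _ (leq_addr _ _)); have := Cemax0 0%N k z.
  move: (_ * _)%E => e e0 re /=.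
  rewrite ge_max (le_trans re) ?leeD2r ?le_max ?lexx//=.
  by apply: (le_trans _ (leeDl _ e0)); rewrite le_max lexx orbT.
have := reward j.+1 k z (g12 _ _ (leq_addr _ _)); set e := (_ * emax _ _ _ _ _ _)%E => re /=.
rewrite ge_max (le_trans re) ?leeD2r ?le_max ?lexx//=.
set w := gstep (bellman a b g2 j k.+1) _ _.
apply: (@le_trans _ _ (w + e)%E); last first.
  by apply: leeD2r; rewrite le_max lexx orbT.
have mv i := @measurable_bellman a b i j k.+1.
rewrite /e /= -gstepZ ?emax_ge0//; [|exact: measurable_emax|by move=> y; exact: emax_ge0].
rewrite -gstepD//; last 4 first.
- exact: mv.
- by apply: measurable_funeM; exact: measurable_emax.
- by move=> y; exact: bellman_ge0.
- by move=> y; rewrite mule_ge0 ?emax_ge0// lee_fin.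
apply: gstep_le => [|||y].
- exact: mv.
- apply: emeasurable_funD; first exact: mv.
  by apply: measurable_funeM; exact: measurable_emax.
- by move=> y; exact: bellman_ge0.
- have /IH/le_trans : forall i y', (i <= k.+1 + j)%N ->
    g1 i y' <= g2 i y' + C * xexp `|y'| by rewrite addSnnS.
  apply; rewrite leeD2l// lee_wpmul2l ?lee_fin//.
  by apply: emax_homo; rewrite le_max lexx.
Qed.

End ChainFunctionals.

(** * Comparison of running maxima *)

Section Comparison.
Context {R : realType}.
Local Notation gauss := (normal_prob (0:R) 1).
Implicit Types (h : R -> \bar R) (a b : nat -> R) (g : nat -> R -> R).

Lemma bellman_ub a b g (K : R) j k z : 1 <= K ->
  (forall k, measurable_fun setT (g k)) -> (forall i y, (i <= k + j)%N -> g i y <= K) ->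
  (bellman a b g j k z <= K%:E)%E.
Proof.
move=> K1 mg; elim: j k z => [|j IH] k z gK /=;
  rewrite ge_max !lee_fin gK ?leq_addr//=.
rewrite -[leRHS](gstep_cst _ (a k * z) (b k)); apply: gstep_le => //.
- exact: measurable_bellman.
- by move=> y; exact: bellman_ge0.
- by move=> y; apply: IH => i y'; rewrite addSnnS; exact: gK.
Qed.

Definition econvex (F : R -> \bar R) := forall l u v : R, 0 <= l <= 1 ->
  (F (l * u + (1 - l) * v)%R <= l%:E * F u + (1 - l)%:E * F v)%E.

(** A point [theta * u] with [`|theta| <= 1] is a barycentre of [u] and [- u]. *)
Lemma even_econvex_le (F : R -> \bar R) (theta u : R) :
  (forall u, 0 <= F u)%E -> (forall u, F (- u) = F u) -> econvex F ->
  `|theta| <= 1 -> (F (theta * u)%R <= F u)%E.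
Proof.
move=> F0 FN cF; rewrite ler_norml => /andP[t1 t2].
have := cF ((1 + theta) / 2) u (- u).
rewrite FN -ge0_muleDl; last 2 first.
- by rewrite lee_fin; lra.
- by rewrite lee_fin; lra.
rewrite -EFinD addrCA subrr addr0 mul1e.
have -> : (1 + theta) / 2 * u + (1 - (1 + theta) / 2) * - u = theta * u.
  by field.
by apply; apply/andP; split; lra.
Qed.

(** Gaussian averaging preserves convexity jointly in the starting point and in
    the dispersion, since the end point [u + v * y] is linear in both. *)
Lemma gstep_barycenter h h1 h2 (l u1 u2 v1 v2 : R) :
  measurable_fun setT h -> measurable_fun setT h1 -> measurable_fun setT h2 ->
  (forall z, 0 <= h z)%E -> (forall z, 0 <= h1 z)%E -> (forall z, 0 <= h2 z)%E ->
  0 <= l <= 1 ->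
  (forall w1 w2 : R, h (l * w1 + (1 - l) * w2)%R <=
     l%:E * h1 w1 + (1 - l)%:E * h2 w2)%E ->
  (gstep h (l * u1 + (1 - l) * u2)%R (l * v1 + (1 - l) * v2)%R <=
   l%:E * gstep h1 u1 v1 + (1 - l)%:E * gstep h2 u2 v2)%E.
Proof.
move=> mh mh1 mh2 h0 h10 h20 /andP[l0 l1] hh.
have l'0 : 0 <= 1 - l by rewrite subr_ge0.
have maff (f : R -> \bar R) (u v : R) : measurable_fun setT f ->
    measurable_fun setT (fun y => f (u + v * y)%R).
  by move=> mf; exact: (measurableT_comp mf (measurable_affine u v)).
rewrite /gstep -!ge0_integralZl//; [|exact: maff|exact: maff].
rewrite -ge0_integralD//; last 4 first.
- by move=> y _; rewrite mule_ge0.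
- by apply: measurable_funeM; exact: maff.
- by move=> y _; rewrite mule_ge0.
- by apply: measurable_funeM; exact: maff.
apply: ge0_le_integral => //.
- exact: maff.
- by apply: emeasurable_funD; apply: measurable_funeM; exact: maff.
move=> y _; apply: le_trans (hh (u1 + v1 * y) (u2 + v2 * y)).
by rewrite le_eqVlt; apply/orP; left; apply/eqP; congr h; ring.
Qed.

Lemma gstep_even h u v : measurable_fun setT h -> (forall z, 0 <= h z)%E ->
  (forall z, h (- z) = h z) -> gstep h (- u) v = gstep h u v.
Proof.
move=> mh h0 hN; rewrite -[RHS]gstep_opp//; apply: eq_integral => y _.
by rewrite -hN; congr h; ring.
Qed.

(** For an even convex profile, a smaller slope and a smaller dispersion both
    lower the mean: each of them is an even convex parameter of the mean. *)
Lemma gstep_contract h (al u v v' : R) : measurable_fun setT h ->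
  (forall z, 0 <= h z)%E -> (forall z, h (- z) = h z) ->
  econvex h -> 0 <= al <= 1 -> 0 <= v <= v' ->
  (gstep h (al * u)%R v <= gstep h u v')%E.
Proof.
move=> mh h0 hN ch /andP[al0 al1] /andP[v0 vv'].
have slope : (gstep h (al * u)%R v <= gstep h u v)%E.
  apply: (@even_econvex_le (fun u => gstep h u v)).
  - by move=> w; exact: gstep_ge0.
  - by move=> w; exact: gstep_even.
  - move=> l w1 w2 l01; have := gstep_barycenter w1 w2 v v mh mh mh h0 h0 h0 l01
      (fun w1 w2 => ch l w1 w2 l01).
    by rewrite -mulrDl addrCA subrr addr0 mul1r.
  - by rewrite ger0_norm.
apply: (le_trans slope).
have [v'0|v'0] := eqVneq v' 0.
  by rewrite (_ : v = v')//; apply/eqP; rewrite eq_le vv' v'0.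
have v'p : 0 < v' by rewrite lt_def v'0 (le_trans v0).
rewrite -{1}(divfK v'0 v).
apply: (@even_econvex_le (fun v => gstep h u v)).
- by move=> w; exact: gstep_ge0.
- by move=> w; exact: gstep_opp.
- move=> l w1 w2 l01; have := gstep_barycenter u u w1 w2 mh mh mh h0 h0 h0 l01
      (fun w1 w2 => ch l w1 w2 l01).
  by rewrite -mulrDl addrCA subrr addr0 mul1r.
- rewrite ger0_norm; last by rewrite divr_ge0// ltW.
  by rewrite ler_pdivrMr// mul1r.
Qed.

Lemma emax_even a b j k m z : emax a b j k m (- z) = emax a b j k m z.
Proof.
elim: j k m z => [|j IH] k m z /=; rewrite normrN// mulrN gstep_even//.
- exact: measurable_emax.
- by move=> y; exact: emax_ge0.
Qed.

Lemma emax_convex a b j k (l m1 m2 z1 z2 : R) : 0 <= l <= 1 ->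
  (emax a b j k (l * m1 + (1 - l) * m2)%R (l * z1 + (1 - l) * z2)%R <=
   l%:E * emax a b j k m1 z1 + (1 - l)%:E * emax a b j k m2 z2)%E.
Proof.
move=> l01; have /andP[l0 l1] := l01.
have l'0 : 0 <= 1 - l by rewrite subr_ge0.
have maxM m1' m2' z1' z2' : Num.max (l * m1' + (1 - l) * m2') `|l * z1' + (1 - l) * z2'| <=
    l * Num.max m1' `|z1'| + (1 - l) * Num.max m2' `|z2'|.
  rewrite ge_max; apply/andP; split.
    by apply: lerD; apply: ler_wpM2l => //; rewrite le_max lexx.
  apply: (le_trans (ler_normD _ _)); rewrite !normrM (ger0_norm l0) (ger0_norm l'0).
  by apply: lerD; apply: ler_wpM2l => //; rewrite le_max lexx orbT.
elim: j k m1 m2 z1 z2 => [|j IH] k m1 m2 z1 z2 /=.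
  rewrite -!EFinM -EFinD lee_fin.
  apply: le_trans (xexp_convex l01 _ _); rewrite ?maxabs_ge0//.
  by apply: xexp_le; rewrite ?maxabs_ge0.
have -> : a k * (l * z1 + (1 - l) * z2) = l * (a k * z1) + (1 - l) * (a k * z2).
  by ring.
have {1}-> : b k = l * b k + (1 - l) * b k by ring.
apply: gstep_barycenter => //; try exact: measurable_emax;
  try by move=> w; exact: emax_ge0.
move=> w1 w2; apply: (le_trans _ (IH _ _ _ _ _)).
by apply: emax_homo.
Qed.

(** Pulling a chain towards the origin ([a <= 1]) and reducing its noise lowers
    its running maximum in the mean of [xexp]: the profile of the random walk
    is convex and even, so that [gstep_contract] applies at each step. *)
Lemma emax_compare a b b' j k m z :
  (forall i, (k <= i < k + j)%N -> 0 <= a i <= 1) ->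
  (forall i, (k <= i < k + j)%N -> 0 <= b i <= b' i) ->
  (emax a b j k m z <= emax (fun=> 1%R) b' j k m z)%E.
Proof.
elim: j k m z => [//|j IH] k m z ha hb /=.
set m' := Num.max m _; set H := emax (fun=> 1) b' j k.+1 m'.
have mH : measurable_fun setT H by exact: measurable_emax.
have H0 y : (0 <= H y)%E by exact: emax_ge0.
apply: (@le_trans _ _ (gstep H (a k * z) (b k))).
  apply: gstep_le => //; first exact: measurable_emax.
    by move=> y; exact: emax_ge0.
  by move=> y; apply: IH => i /andP[ki ik]; [apply: ha|apply: hb];
    rewrite (ltnW ki) addnS -addSn.
rewrite mul1r; apply: gstep_contract => //.
- by move=> y; exact: emax_even.
- move=> l u v l01; apply: le_trans (emax_convex _ _ _ _ _ _ _ _ l01).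
  by rewrite -mulrDl addrCA subrr addr0 mul1r.
- by apply: ha; rewrite leqnn addnS ltnS leq_addr.
- by apply: hb; rewrite leqnn addnS ltnS leq_addr.
Qed.

End Comparison.

(** * A maximal inequality for random walks *)

Section MaximalInequality.
Context {R : realType}.
Implicit Types (h : R -> \bar R) (b : nat -> R) (m z v : R).

(** Chosen because it dominates [expR `|z|] and is, up to a constant factor,
    preserved by Gaussian averaging. *)
Definition cosh2 z : R := expR z + expR (- z).

Lemma cosh2_ge0 z : 0 <= cosh2 z.
Proof. by rewrite addr_ge0// expR_ge0. Qed.

Lemma cosh2_norm z : cosh2 `|z| = cosh2 z.
Proof.
have [z0|z0] := leP 0 z; first by rewrite ger0_norm.
by rewrite ltr0_norm// /cosh2 opprK addrC.
Qed.

Lemma cosh2_le z z' : 0 <= z -> z <= z' -> cosh2 z <= cosh2 z'.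
Proof.
move=> z0 zz'; rewrite /cosh2 !expRN.
have e1 : 1 <= expR z by rewrite -expR0 ler_expR.
have e2 : expR z <= expR z' by rewrite ler_expR.
rewrite -subr_ge0.
have -> : expR z' + (expR z')^-1 - (expR z + (expR z)^-1) =
    (expR z' - expR z) * (1 - (expR z' * expR z)^-1).
  by field; rewrite !gt_eqF ?expR_gt0.
rewrite mulr_ge0// ?subr_ge0// invf_le1 ?mulr_gt0 ?expR_gt0//.
by rewrite mulr_ege1// (le_trans e1).
Qed.

Lemma measurable_cosh2 (c : R) : measurable_fun setT (fun z => cosh2 (c * z)).
Proof.
apply: measurable_funD; apply: measurableT_comp => //.
by apply: measurableT_comp.
Qed.

Lemma measurable_expRM (c : R) : measurable_fun setT (fun z => (expR (c * z))%:E).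
Proof. by apply/measurable_EFinP; apply: measurableT_comp. Qed.

Lemma gstep_cosh2 (c u v : R) : gstep (fun z => (cosh2 (c * z))%:E) u v =
  (cosh2 (c * u) * expR ((c * v) ^+ 2 / 2))%:E.
Proof.
have -> : (fun z => (cosh2 (c * z))%:E) =
    (fun z => (expR (c * z))%:E + (expR (- c * z))%:E)%E.
  by apply/funext => z; rewrite -EFinD /cosh2 mulNr.
rewrite gstepD; do ?exact: measurable_expRM; last 2 first.
- by move=> z; rewrite lee_fin expR_ge0.
- by move=> z; rewrite lee_fin expR_ge0.
by rewrite !gstep_expR -EFinD /cosh2 !mulNr sqrrN mulrDl.
Qed.

(** The second moment of [cosh2] after [j] steps of standard deviation [v]. *)
Definition cosh2_moment2 v (j : nat) z : R :=
  2 + cosh2 (2 * z) * expR (2 * j%:R * v ^+ 2).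

Lemma gstep_cosh2_moment2 v j z :
  gstep (EFin \o cosh2_moment2 v j) z v = (cosh2_moment2 v j.+1 z)%:E.
Proof.
have -> : EFin \o cosh2_moment2 v j =
    (fun z => 2%:E + (expR (2 * j%:R * v ^+ 2))%:E * (cosh2 (2 * z))%:E)%E.
  by apply/funext => w /=; rewrite -EFinM -EFinD mulrC.
have mc : measurable_fun setT (fun z : R => (cosh2 (2 * z))%:E).
  by apply/measurable_EFinP; exact: measurable_cosh2.
have c0 w : (0 <= (cosh2 w)%:E)%E by rewrite lee_fin cosh2_ge0.
rewrite gstepD//; last 2 first.
- exact: measurable_funeM.
- by move=> w; rewrite mule_ge0// lee_fin expR_ge0.
rewrite gstep_cst gstepZ ?expR_ge0// gstep_cosh2 -EFinM -EFinD.
congr (2 + _)%:E; rewrite mulrCA -expRD; congr (_ * expR _).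
by rewrite -[j.+1%:R]natr1; field.
Qed.

(** Doob's quadratic maximal inequality for the submartingale [cosh2 (z_k)],
    in the form of a potential: [2 M^2 - 4 M Y] is a supersolution of the
    problem of maximising [M^2 - 4 Y^2] over the running maximum [M] of [Y]. *)
Lemma emax_doob v j k m z :
  (emax (fun=> 1%R) (fun=> v) j k m z +
     (4 * cosh2 (Num.max m `|z|) * cosh2 z)%:E <=
   (4 * cosh2_moment2 v j z + 2 * cosh2 (Num.max m `|z|) ^+ 2)%:E)%E.
Proof.
elim: j k m z => [|j IH] k m z /=.
  set M := Num.max m _; have M0 : 0 <= M by exact: maxabs_ge0.
  rewrite -EFinD lee_fin /cosh2_moment2 mulr0 mul0r expR0 mulr1.
  have -> : 2 + cosh2 (2 * z) = cosh2 z ^+ 2.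
    rewrite /cosh2 sqrrD -expRD subrr expR0 -!expRM_natl mulrN; lra.
  have phiM : xexp M <= cosh2 M ^+ 2.
    have h1 : xexp M <= expR M ^+ 2.
      rewrite expr2 ler_wpM2r ?expR_ge0//.
      by apply: le_trans (expR_ge1Dx _); lra.
    apply: (le_trans h1); rewrite ler_sqr ?nnegrE ?expR_ge0 ?cosh2_ge0//.
    by rewrite lerDl expR_ge0.
  move: phiM; move: (xexp M) (cosh2 M) (cosh2 z) => p c c' pc.
  have := sqr_ge0 (c - 2 * c'); nra.
set M := Num.max m _; have M0 : 0 <= M by exact: maxabs_ge0.
set H := emax _ _ j k.+1 M.
have mH : measurable_fun setT H by exact: measurable_emax.
have H0 w : (0 <= H w)%E by exact: emax_ge0.
have mc : measurable_fun setT (fun w => (cosh2 w)%:E : \bar R).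
  apply/measurable_EFinP; have := measurable_cosh2 1.
  by under eq_fun do rewrite mul1r.
have mm : measurable_fun setT (EFin \o cosh2_moment2 v j).
  apply/measurable_EFinP; apply: measurable_funD => //.
  by apply: measurable_funM => //; exact: measurable_cosh2.
have mom0 i w : 0 <= cosh2_moment2 v i w.
  by rewrite addr_ge0// mulr_ge0 ?cosh2_ge0 ?expR_ge0.
have pointwise w : (H w + (4 * cosh2 M)%:E * (cosh2 w)%:E <=
    4%:E * (cosh2_moment2 v j w)%:E + (2 * cosh2 M ^+ 2)%:E)%E.
  have := IH k.+1 M w; rewrite -/H.
  have : cosh2 M <= cosh2 (Num.max M `|w|).
    by rewrite cosh2_le// le_max lexx.
  have : Num.max M `|w| = M \/ cosh2 (Num.max M `|w|) = cosh2 w.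
    by rewrite maxEle; case: ifPn => _; [right; rewrite cosh2_norm|left].
  move: (H w) (H0 w) => [r| |]//= r0.
  rewrite -!EFinM -!EFinD !lee_fin => -[->|->]; first by lra.
  move: (cosh2 M) (cosh2 w) (cosh2_ge0 M) => c c' c0 cc'; nra.
apply: (@le_trans _ _ (gstep (fun w => H w + (4 * cosh2 M)%:E * (cosh2 w)%:E)%E
    (1 * z) v)).
  rewrite gstepD//; last 2 first.
  - exact: measurable_funeM.
  - by move=> w; rewrite mule_ge0// lee_fin ?mulr_ge0 ?cosh2_ge0.
  rewrite gstepZ//; last 2 first.
  - by move=> w; rewrite lee_fin cosh2_ge0.
  - by rewrite mulr_ge0// cosh2_ge0.
  rewrite leeD2l// EFinM lee_wpmul2l ?lee_fin ?mulr_ge0 ?cosh2_ge0//.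
  have := gstep_cosh2 1 (1 * z) v; under [X in gstep X]eq_fun do rewrite mul1r.
  move=> ->; rewrite !mul1r lee_fin ler_peMr ?cosh2_ge0//.
  by rewrite -expR0 ler_expR divr_ge0// sqr_ge0.
rewrite mul1r.
apply: (@le_trans _ _ (gstep (fun w => 4%:E * (cosh2_moment2 v j w)%:E +
    (2 * cosh2 M ^+ 2)%:E)%E z v)).
  apply: gstep_le => //.
  - by apply: emeasurable_funD => //; exact: measurable_funeM.
  - by apply: emeasurable_funD => //; exact: measurable_funeM.
  - by move=> w; rewrite adde_ge0// mule_ge0// lee_fin ?mulr_ge0 ?cosh2_ge0.
rewrite gstepD//; last 3 first.
- exact: measurable_funeM.
- by move=> w; rewrite mule_ge0// lee_fin.
- by move=> w; rewrite lee_fin mulr_ge0// sqr_ge0.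
rewrite gstep_cst gstepZ//; last by move=> w; rewrite lee_fin.
by rewrite gstep_cosh2_moment2 -EFinM -EFinD.
Qed.

Lemma emax_walk_bounded v j k : j%:R * v ^+ 2 <= 1 ->
  (emax (fun=> 1%R) (fun=> v) j k 0 0 <= (8 + 8 * expR 2)%:E)%E.
Proof.
move=> jv; have := emax_doob v j k 0 0.
rewrite normr0 maxxx; move: (emax _ _ _ _ _ _) (emax_ge0 (fun=> 1%R) (fun=> v) j k 0 0).
move=> [r| |]//= _; rewrite -EFinD !lee_fin /cosh2_moment2 mulr0.
have -> : cosh2 0 = 2 :> R by rewrite /cosh2 oppr0 expR0.
have : expR (2 * j%:R * v ^+ 2) <= expR 2 by rewrite ler_expR -mulrA; lra.
lra.
Qed.

End MaximalInequality.

(** * Gaussian chains on a probability space *)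

Section ImageProbability.
Context {d1 d2 : measure_display} {T1 : measurableType d1}
  {T2 : measurableType d2} {R : realType}.

(** The image measure again, as a probability: products of measures require
    their factors to be sigma-finite. *)
Definition image_prob (P : probability T1 R) (f : T1 -> T2)
    (mf : measurable_fun setT f) : probability T2 R :=
  distribution P (HB.pack f (isMeasurableFun.Build _ _ _ _ f mf) : {mfun T1 >-> T2}).

Lemma integral_image_prob P f mf (h : T2 -> \bar R) :
  measurable_fun setT h -> (forall y, 0 <= h y)%E ->
  (\int[@image_prob P f mf]_y h y = \int[P]_x h (f x))%E.
Proof. by move=> mh h0; exact: (integral_image_measure P mf). Qed.

End ImageProbability.

Section Independence.
Context {R : realType} {d : measure_display} {Omega : measurableType d}.
Variable P : probability Omega R.
Implicit Types F : set (set Omega).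

Definition fmeas F d' (T : measurableType d') (f : Omega -> T) :=
  forall B, measurable B -> F (f @^-1` B).

Lemma fmeasP F d' (T : measurableType d') (f : Omega -> T) :
  sigma_algebra setT F ->
  fmeas F f <-> measurable_fun setT (f : g_sigma_algebraType F -> T).
Proof.
move=> sF; split => [Ff _ B mB|mf B mB].
  by rewrite setTI; apply: sub_sigma_algebra; exact: Ff.
have := mf measurableT B mB; rewrite setTI => /=.
by rewrite /measurable /= (sigma_algebra_id sF).
Qed.

Lemma fmeas_measurable F d' (T : measurableType d') (f : Omega -> T) :
  F `<=` measurable -> fmeas F f -> measurable_fun setT f.
Proof. by move=> Fm Ff _ B mB; rewrite setTI; exact/Fm/Ff. Qed.

(** Independence lets one integrate the second variable first: the joint law
    agrees with the product measure on rectangles, hence everywhere. *)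
Lemma integral_indep F d' (T : measurableType d') (zeta : Omega -> T)
    (I : Omega -> R) (v : R) (f : T * R -> \bar R) :
  F `<=` measurable -> fmeas F zeta -> measurable_fun setT I ->
  (forall A B, F A -> measurable B -> P (A `&` [set w | B (I w)]) =
     (P A * normal_prob 0 1 [set y | B (v * y)%R])%E) ->
  measurable_fun setT f -> (forall p, 0 <= f p)%E ->
  (\int[P]_w f (zeta w, I w) = \int[P]_w gstep (fun y => f (zeta w, y)) 0 v)%E.
Proof.
move=> Fm Fz mI ind mf f0.
have mz := fmeas_measurable Fm Fz.
have mv : measurable_fun setT (fun y : R => v * y) by exact: measurable_funM.
pose nu := image_prob (normal_prob (0:R) 1) mv.
pose mu := image_prob P mz.
have mzI : measurable_fun setT (fun w => (zeta w, I w)) by exact: measurable_fun_pair.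
transitivity (\int[image_measure P mzI]_p f p)%E; first by rewrite integral_image_measure.
transitivity (\int[mu \x nu]_p f p)%E.
  apply: eq_measure_integral => A mA _; apply/esym; apply: product_measure_unique => //.
  move=> B C mB mC.
  by rewrite image_measureE; apply: ind => //; exact: Fz.
rewrite fubini_tonelli1// /fubini_F.
transitivity (\int[P]_w \int[nu]_y f (zeta w, y))%E.
  apply: (integral_image_prob P mz (h := fun z => \int[nu]_y f (z, y)))%E.
    exact: measurable_fun_fubini_tonelli_F.
  by move=> z; exact: integral_ge0.
apply: eq_integral => w _.
transitivity (\int[normal_prob (0:R) 1]_y f (zeta w, v * y)%R)%E.
  apply: (integral_image_prob (normal_prob (0:R) 1) mv (h := fun y => f (zeta w, y))).
    by apply: (measurableT_comp mf); exact: measurable_fun_pair.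
  by [].
by apply: eq_integral => y _; rewrite add0r.
Qed.
End Independence.

Section SigmaAlgebra.
Context {T : pointedType}.
Variable F : set (set T).
Hypothesis sF : sigma_algebra setT F.

Lemma sigma_algebra_measurableE A :
  measurable (A : set (g_sigma_algebraType F)) = F A.
Proof. by rewrite /measurable /= (sigma_algebra_id sF). Qed.

Lemma sigma_setT : F setT.
Proof. by rewrite -sigma_algebra_measurableE. Qed.

Lemma sigma_setC A : F A -> F (~` A).
Proof. by rewrite -!sigma_algebra_measurableE; exact: measurableC. Qed.

Lemma sigma_setI A B : F A -> F B -> F (A `&` B).
Proof. by rewrite -!sigma_algebra_measurableE; exact: measurableI. Qed.

Lemma sigma_setU A B : F A -> F B -> F (A `|` B).
Proof. by rewrite -!sigma_algebra_measurableE; exact: measurableU. Qed.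

Lemma sigma_setD A B : F A -> F B -> F (A `\` B).
Proof. by rewrite -!sigma_algebra_measurableE; exact: measurableD. Qed.

End SigmaAlgebra.

Section Chain.
Context {R : realType} {d : measure_display} {Omega : measurableType d}.
Variable P : probability Omega R.

(** The filtration [F] may be larger than the one generated by [Z]: the step
    after time [k] is required to be independent of [F k]. *)
Record gaussian_chain (n : nat) (F : nat -> set (set Omega)) (a b : nat -> R)
    (Z : nat -> Omega -> R) : Prop := GaussianChain {
  gc_sigma : forall k, sigma_algebra setT (F k);
  gc_sub : forall k, F k `<=` measurable;
  gc_mono : forall k, (k < n)%N -> F k `<=` F k.+1;
  gc_adapted : forall k, (k <= n)%N -> fmeas (F k) (Z k);
  gc_step : forall k, (k < n)%N -> forall A B, F k A -> measurable B ->
    P (A `&` [set w | B (Z k.+1 w - a k * Z k w)]) =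
    (P A * normal_prob 0 1 [set y | B (b k * y)%R])%E }.

Variables (n : nat) (F : nat -> set (set Omega)) (a b : nat -> R).
Variables (Z : nat -> Omega -> R).
Hypothesis chain : gaussian_chain n F a b Z.

Let sF k := gc_sigma chain k.

Let FS i k : (i <= k <= n)%N -> F i `<=` F k.
Proof.
elim: k => [|k IH]; first by rewrite leqn0 => /andP[/eqP -> _] A.
rewrite leq_eqVlt ltnS => /andP[/orP[/eqP->|ik] kn]; first by move=> A.
have ikn : (i <= k <= n)%N by rewrite ik (ltnW kn).
exact: (subset_trans (IH ikn) (gc_mono chain kn)).
Qed.

Let mZ k : (k <= n)%N -> measurable_fun setT (Z k).
Proof. by move=> kn; exact: (fmeas_measurable (@gc_sub _ _ _ _ _ chain k) (gc_adapted chain kn)). Qed.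

(** The Markov property, with a parameter [zeta] known at time [k]. *)
Lemma integral_chain_step k d' (T : measurableType d') (zeta : Omega -> T)
    (f : T * R -> \bar R) : (k < n)%N -> fmeas (F k) zeta ->
  measurable_fun setT f -> (forall p, 0 <= f p)%E ->
  (\int[P]_w f (zeta w, Z k.+1 w) =
   \int[P]_w gstep (fun z => f (zeta w, z)) (a k * Z k w)%R (b k))%E.
Proof.
move=> kn Fz mf f0; have Fk := gc_adapted chain (ltnW kn).
have Fpair : fmeas (F k) (fun w => (zeta w, Z k w)).
  apply/(fmeasP _ (sF k)); apply: measurable_fun_pair.
    exact/(fmeasP _ (sF k)).
  exact/(fmeasP _ (sF k)).
have mI : measurable_fun setT (fun w => Z k.+1 w - a k * Z k w).
  apply: measurable_funB; first exact: mZ.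
  by apply: measurable_funM => //; apply: mZ; exact: ltnW.
have mg : measurable_fun setT (fun p : T * R * R => f (p.1.1, a k * p.1.2 + p.2)).
  apply: (measurableT_comp mf); apply: measurable_fun_pair.
    exact: measurableT_comp.
  apply: measurable_funD => //; apply: measurable_funM => //.
  exact: measurableT_comp.
have := integral_indep (@gc_sub _ _ _ _ _ chain k) Fpair mI (gc_step chain kn) mg.
rewrite /= => H; transitivity (\int[P]_w
    f (zeta w, (a k * Z k w + (Z k.+1 w - a k * Z k w))%R))%E.
  by apply: eq_integral => w _; rewrite addrC subrK.
apply: etrans (H _) _; first by move=> p; exact: f0.
by apply: eq_integral => w _; apply: eq_integral => y _; rewrite add0r.
Qed.

Lemma fmeas_indic k A : F k A -> fmeas (F k) (\1_A : Omega -> R).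
Proof.
move=> FA; apply/(fmeasP _ (sF k)); apply: measurable_indic.
by rewrite (sigma_algebra_measurableE (sF k)).
Qed.

Lemma integral_chain_step_on k A (h : R -> \bar R) : (k < n)%N -> F k A ->
  measurable_fun setT h -> (forall z, 0 <= h z)%E ->
  (\int[P]_w ((\1_A w)%:E * h (Z k.+1 w)) =
   \int[P]_w ((\1_A w)%:E * gstep h (a k * Z k w)%R (b k)))%E.
Proof.
move=> kn FA mh h0.
have := @integral_chain_step k _ R (\1_A) (fun p => (`|p.1|%:E * h p.2)%E) kn
  (fmeas_indic FA).
rewrite /=; under eq_integral do rewrite (@ger0_norm _ (\1_A _))//.
move=> ->.
- apply: eq_integral => w _; rewrite gstepZ//.
  by rewrite (@ger0_norm _ (\1_A _)).
- apply: emeasurable_funM; last exact: measurableT_comp.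
  by apply/measurable_EFinP; apply: measurableT_comp.
- by move=> p; rewrite mule_ge0// lee_fin.
Qed.

(** * The running maximum *)

Fixpoint running_max (k : nat) (w : Omega) : R :=
  if k is k'.+1 then Num.max (running_max k' w) `|Z k' w| else 0.

Lemma fmeas_running_max k : (k <= n)%N -> fmeas (F k) (running_max k.+1).
Proof.
elim: k => [|k IH] kn; apply/(fmeasP _ (sF _)); apply: measurable_maxabs.
- exact: measurable_cst.
- by apply/(fmeasP _ (sF _)); exact: (gc_adapted chain kn).
- apply/(fmeasP _ (sF _)) => B mB.
  by apply: (gc_mono chain kn); exact: (IH (ltnW kn)).
- by apply/(fmeasP _ (sF _)); exact: (gc_adapted chain kn).
Qed.

Let integral_start (h : R -> \bar R) z : {ae P, forall w, Z 0%N w = z} ->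
  measurable_fun setT h -> (forall z, 0 <= h z)%E ->
  (\int[P]_w h (Z 0%N w) = h z)%E.
Proof.
move=> Z0 mh h0; rewrite -[RHS]mule1 -(@probability_setT _ _ _ P).
rewrite -integral_cst//; apply: ge0_ae_eq_integral => //.
- exact: (measurableT_comp mh (mZ (leq0n n))).
- by move=> w _; exact: h0.
- by move: Z0; apply: filterS => w -> _.
Qed.

(** Backward induction on the pair formed by the running maximum and the
    current position, which is Markov. *)
Lemma integral_running_max : {ae P, forall w, Z 0%N w = 0} ->
  (\int[P]_w (xexp (running_max n.+1 w))%:E = emax a b n 0%N 0 0)%E.
Proof.
move=> Z0.
have claim j k : (k + j = n)%N -> (\int[P]_w (xexp (running_max n.+1 w))%:E =
    \int[P]_w emax a b j k (running_max k w) (Z k w))%E.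
  elim: j k => [|j IH] k; first by rewrite addn0 => ->.
  move=> kjn; have kn : (k < n)%N by rewrite -kjn addnS ltnS leq_addr.
  rewrite (IH k.+1); last by rewrite addSnnS.
  apply: (integral_chain_step (f := fun p => emax a b j k.+1 p.1 p.2) kn).
  - by apply: fmeas_running_max; exact: ltnW.
  - exact: measurable_emax_param.
  - by move=> p; exact: emax_ge0.
rewrite (claim n 0%N)//; apply: (integral_start Z0).
- exact: measurable_emax.
- by move=> z; exact: emax_ge0.
Qed.

(** * Optimal stopping *)

Variable g : nat -> R -> R.
Hypothesis mg : forall k, measurable_fun setT (g k).
Hypothesis g0 : forall k z, 0 <= g k z.

(** Nothing is asked beyond step [n]: index [n.+1] is the terminal time, known
    in advance. *)
Definition stop_index (kappa : Omega -> nat) :=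
  forall k, (k <= n)%N -> F k [set w | (kappa w <= k)%N].

Definition reward (kappa : Omega -> nat) (w : Omega) : \bar R :=
  if (kappa w <= n)%N then (g (kappa w) (Z (kappa w) w))%:E else 1%E.

Lemma reward_ge0 kappa w : (0 <= reward kappa w)%E.
Proof. by rewrite /reward; case: ifPn => _; rewrite ?lee_fin. Qed.

Lemma emeasurable_indicM A (f : Omega -> \bar R) : measurable A ->
  measurable_fun setT f -> measurable_fun setT (fun w => (\1_A w)%:E * f w)%E.
Proof.
move=> mA mf; apply: emeasurable_funM => //.
by apply/measurable_EFinP; exact: measurable_indic.
Qed.

Let mval j k := @measurable_bellman R a b g j k mg.

Let mvalZ j k : (k <= n)%N -> measurable_fun setT (fun w => bellman a b g j k (Z k w)).
Proof. by move=> kn; exact: (measurableT_comp (mval j k) (mZ kn)). Qed.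

Let cont j k z := gstep (bellman a b g j k.+1) (a k * z) (b k).

Let mcont j k : measurable_fun setT (cont j k).
Proof.
apply: (@measurable_gstep_param _ _ R (fun p => bellman a b g j k.+1 p.2)
  (fun z => a k * z) (fun=> b k)) => //.
- exact: (measurableT_comp (mval j k.+1)).
- by move=> p; exact: bellman_ge0.
- exact: measurable_funM.
Qed.

Let cont_ge0 j k z : (0 <= cont j k z)%E.
Proof. by apply: gstep_ge0 => y; exact: bellman_ge0. Qed.

Let indic_ge0 (A : set Omega) w (e : \bar R) : (0 <= e)%E ->
  (0 <= (\1_A w)%:E * e)%E.
Proof. by move=> e0; rewrite mule_ge0// lee_fin. Qed.

(** Dynamic programming, upper half: from step [k] on, no rule collects more
    than [bellman] on the event that it has not yet stopped. *)
Lemma integral_reward_le kappa z : {ae P, forall w, Z 0%N w = z} ->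
  stop_index kappa -> measurable_fun setT (reward kappa) /\
  (\int[P]_w reward kappa w <= bellman a b g n 0%N z)%E.
Proof.
move=> Z0 st.
pose ge k : set Omega := [set w | (k <= kappa w)%N].
have Fge k : (k <= n)%N -> F k (ge k).
  case: k => [_|k kn].
    by rewrite (_ : ge 0%N = setT); [exact: (sigma_setT (sF _))|exact/seteqP].
  rewrite (_ : ge k.+1 = ~` [set w | (kappa w <= k)%N]).
    apply: (sigma_setC (sF _)); apply: (gc_mono chain kn).
    by apply: st; exact: ltnW.
  by apply/seteqP; split => w; rewrite /ge /= ltnNge => /negP.
pose eq k : set Omega := ge k `&` [set w | (kappa w <= k)%N].
pose gt k : set Omega := ge k `\` [set w | (kappa w <= k)%N].
have Feq k : (k <= n)%N -> F k (eq k).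
  by move=> kn; apply: (sigma_setI (sF _)); [exact: Fge|exact: st].
have Fgt k : (k <= n)%N -> F k (gt k).
  by move=> kn; apply: (sigma_setD (sF _)); [exact: Fge|exact: st].
have gtE k : gt k = ge k.+1.
  apply/seteqP; split => w; rewrite /gt /ge /=.
    by move=> [_ /negP]; rewrite -ltnNge.
  by move=> kw; split; [exact: ltnW|apply/negP; rewrite -ltnNge].
have indicb (A : set Omega) (p : pred Omega) w : (A w <-> p w) -> \1_A w = (p w)%:R :> R.
  move=> Ap; rewrite indicE (_ : (w \in A) = p w)//.
  by apply/idP/idP => [|/Ap]; rewrite inE// => /Ap.
have ige k w : \1_(ge k) w = (k <= kappa w)%N%:R :> R.
  by apply: (indicb _ (fun w => (k <= kappa w)%N)).
have ieq k w : \1_(eq k) w = (kappa w == k)%:R :> R.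
  apply: (indicb _ (fun w => kappa w == k)).
  by rewrite eqn_leq /eq /ge /=; split => [[-> ->]//|/andP[]].
have igt k w : \1_(gt k) w = (k < kappa w)%N%:R :> R by rewrite gtE ige.
have rewardE k w : (k <= n)%N -> ((\1_(ge k) w)%:E * reward kappa w =
    (\1_(eq k) w)%:E * (g k (Z k w))%:E + (\1_(gt k) w)%:E * reward kappa w)%E.
  move=> kn; rewrite ige ieq igt /reward.
  have [kk|kk|<-] := ltngtP k (kappa w); rewrite ?mul0e ?mul1e ?add0e ?adde0//.
  by rewrite kn.
have valE j k w : ((\1_(eq k) w)%:E * (g k (Z k w))%:E +
     (\1_(gt k) w)%:E * (if j is j'.+1 then cont j' k (Z k w) else 1) <=
    (\1_(ge k) w)%:E * bellman a b g j k (Z k w))%E.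
  rewrite ige ieq igt; have [kk|kk|_] := ltngtP k (kappa w);
    rewrite ?mul0e ?mul1e ?add0e ?adde0//; case: j => [|j] /=;
    by rewrite le_max lexx ?orbT.
have mP k A : F k A -> measurable A by exact: (@gc_sub _ _ _ _ _ chain).
have mgZ k : (k <= n)%N -> measurable_fun setT (fun w => (g k (Z k w))%:E).
  by move=> kn; apply/measurable_EFinP; exact: (measurableT_comp (mg k) (mZ kn)).
have claim j k : (k + j = n)%N ->
    measurable_fun setT (fun w => (\1_(ge k) w)%:E * reward kappa w)%E /\
    (\int[P]_w ((\1_(ge k) w)%:E * reward kappa w) <=
     \int[P]_w ((\1_(ge k) w)%:E * bellman a b g j k (Z k w)))%E.
  elim: j k => [|j IH] k kjn.
    have kn : (k <= n)%N by rewrite -kjn addn0.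
    have E : (fun w => (\1_(ge k) w)%:E * reward kappa w)%E =
        (fun w => (\1_(eq k) w)%:E * (g k (Z k w))%:E + (\1_(gt k) w)%:E * 1)%E.
      apply/funext => w; rewrite rewardE// igt /reward.
      case: ifPn => // kw.
      have -> : (k < kappa w)%N = false by rewrite ltnNge -(addn0 k) kjn kw.
      by rewrite !mul0e.
    have mE : measurable_fun setT (fun w => (\1_(ge k) w)%:E * reward kappa w)%E.
      rewrite E; apply: emeasurable_funD; apply: emeasurable_indicM => //.
      - by apply: (mP k); exact: Feq.
      - exact: mgZ.
      - by apply: (mP k); exact: Fgt.
    split => //; apply: ge0_le_integral => //.
    - by move=> w _; apply: indic_ge0; exact: reward_ge0.
    - by apply: emeasurable_indicM; [apply: (mP k); exact: Fge|exact: mvalZ].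
    - move=> w _; have -> := congr1 (fun f => f w) E; exact: (valE 0%N).
  have kn : (k < n)%N by rewrite -kjn addnS ltnS leq_addr.
  have [mS IS] := IH k.+1 (etrans (addSnnS _ _) kjn).
  have m1 : measurable_fun setT (fun w => (\1_(eq k) w)%:E * (g k (Z k w))%:E)%E.
    apply: emeasurable_indicM; [apply: (mP k); apply: Feq|apply: mgZ]; exact: ltnW.
  have m2 : measurable_fun setT (fun w => (\1_(gt k) w)%:E * reward kappa w)%E.
    by rewrite gtE.
  have E : (fun w => (\1_(ge k) w)%:E * reward kappa w)%E =
      (fun w => (\1_(eq k) w)%:E * (g k (Z k w))%:E + (\1_(gt k) w)%:E * reward kappa w)%E.
    by apply/funext => w; rewrite rewardE// ltnW.
  split; first by rewrite E; exact: emeasurable_funD.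
  rewrite E ge0_integralD//; last 2 first.
  - by move=> w _; apply: indic_ge0; rewrite lee_fin.
  - by move=> w _; apply: indic_ge0; exact: reward_ge0.
  have m3 : measurable_fun setT (fun w => (\1_(gt k) w)%:E * cont j k (Z k w))%E.
    apply: emeasurable_indicM; first by apply: (mP k); apply: Fgt; exact: ltnW.
    exact: (measurableT_comp (mcont j k) (mZ (ltnW kn))).
  apply: (@le_trans _ _ (\int[P]_w ((\1_(eq k) w)%:E * (g k (Z k w))%:E) +
      \int[P]_w ((\1_(gt k) w)%:E * cont j k (Z k w)))%E).
    rewrite leeD2l//; move: IS; rewrite -gtE => /le_trans; apply.
    rewrite (integral_chain_step_on kn)//; first exact/Fgt/ltnW.
    by move=> z'; exact: bellman_ge0.
  rewrite -ge0_integralD//; last 2 first.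
  - by move=> w _; apply: indic_ge0; rewrite lee_fin.
  - by move=> w _; apply: indic_ge0; exact: cont_ge0.
  apply: ge0_le_integral => //.
  - move=> w _; apply: adde_ge0; apply: indic_ge0; first by rewrite lee_fin.
    exact: cont_ge0.
  - exact: emeasurable_funD.
  - apply: emeasurable_indicM; first by apply: (mP k); apply: Fge; exact: ltnW.
    by apply: mvalZ; exact: ltnW.
  - move=> w _; exact: (valE j.+1).
have := claim n 0%N (add0n n).
have ge0E w : \1_(ge 0%N) w = 1 :> R by rewrite ige.
have allE (f : Omega -> \bar R) : (fun w => (\1_(ge 0%N) w)%:E * f w)%E = f.
  by apply/funext => w; rewrite ge0E mul1e.
rewrite !allE.
by rewrite (integral_start Z0)// => z'; exact: bellman_ge0.
Qed.

(** Dynamic programming, lower half: stopping as soon as the reward exceeds the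
    continuation value is optimal, and this rule is built backwards. *)
Lemma optimal_stopping z : {ae P, forall w, Z 0%N w = z} ->
  exists kappa, [/\ forall w, (kappa w <= n.+1)%N, stop_index kappa &
    (\int[P]_w reward kappa w = bellman a b g n 0%N z)%E].
Proof.
move=> Z0.
have mP k A : F k A -> measurable A by exact: (@gc_sub _ _ _ _ _ chain).
have mgZ k : (k <= n)%N -> measurable_fun setT (fun w => (g k (Z k w))%:E).
  by move=> kn; apply/measurable_EFinP; exact: (measurableT_comp (mg k) (mZ kn)).
have Flt k (h : R -> \bar R) : (k <= n)%N -> measurable_fun setT h ->
    F k [set w | ((g k (Z k w))%:E < h (Z k w))%E].
  move=> kn mh; rewrite -(sigma_algebra_measurableE (sF k)).
  have Zm := (fmeasP _ (sF k)).1 (gc_adapted chain kn).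
  rewrite -[X in measurable X]setTI; apply: measurable_lte => //.
    by apply/measurable_EFinP; exact: (measurableT_comp (mg k) Zm).
  exact: (measurableT_comp mh Zm).
have claim j k : (k + j = n)%N -> exists kappa : Omega -> nat,
    [/\ forall w, (k <= kappa w <= n.+1)%N,
      forall i, (k <= i <= n)%N -> F i [set w | (kappa w <= i)%N],
      measurable_fun setT (reward kappa) &
      forall A, F k A -> (\int[P]_w ((\1_A w)%:E * reward kappa w) =
        \int[P]_w ((\1_A w)%:E * bellman a b g j k (Z k w)))%E].
  elim: j k => [|j IH] k kjn.
    have kn : k = n by rewrite -kjn addn0.
    rewrite {}kn {kjn}; pose C : set Omega := [set w | ((g n (Z n w))%:E < 1)%E].
    have FC : F n C by exact: (Flt n (fun=> 1%E)).
    exists (fun w => if w \in C then n.+1 else n).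
    have E : reward (fun w => if w \in C then n.+1 else n) =
        fun w => bellman a b g 0 n (Z n w).
      apply/funext => w; rewrite /reward /=; case: (boolP (w \in C)) => wC.
        by rewrite ltnn; apply/esym/max_idPr/ltW; move: wC; rewrite inE.
      rewrite leqnn; apply/esym/max_idPl; rewrite leNgt; apply/negP => h.
      by move/negP: wC; rewrite inE.
    split.
    - by move=> w; case: ifPn => _; rewrite ?leqnn ?leqnSn.
    - move=> i; rewrite -eqn_leq => /eqP <-.
      rewrite (_ : [set _ | _] = ~` C); first exact: (sigma_setC (sF _)).
      apply/seteqP; split => w /=; case: ifPn; rewrite ?ltnn ?inE//.
        by move=> /negP; rewrite inE.
    - by rewrite E; exact: mvalZ.
    - by move=> A _; rewrite E.
  have kn : (k < n)%N by rewrite -kjn addnS ltnS leq_addr.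
  have [kappa [kge kst mk kint]] := IH k.+1 (etrans (addSnnS _ _) kjn).
  pose C : set Omega := [set w | ((g k (Z k w))%:E < cont j k (Z k w))%E].
  have FC : F k C by apply: (Flt k (cont j k)) => //; exact: ltnW.
  have mC : measurable C by exact: (mP k).
  pose kappa' w := if w \in C then kappa w else k.
  have E (A : set Omega) w : ((\1_A w)%:E * reward kappa' w =
      (\1_(A `\` C) w)%:E * (g k (Z k w))%:E +
      (\1_(A `&` C) w)%:E * reward kappa w)%E.
    rewrite !indicE in_setI in_setD /reward /kappa'.
    case: (w \in C); case: (w \in A) => /=;
      rewrite ?mul0e ?mul1e ?add0e ?adde0//.
    by rewrite (ltnW kn).
  have EV (A : set Omega) w : ((\1_A w)%:E * bellman a b g j.+1 k (Z k w) =
      (\1_(A `\` C) w)%:E * (g k (Z k w))%:E +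
      (\1_(A `&` C) w)%:E * cont j k (Z k w))%E.
    rewrite !indicE in_setI in_setD /= -/(cont j k (Z k w)).
    case: (boolP (w \in C)) => wC; case: (w \in A) => /=;
      rewrite ?mul0e ?mul1e ?add0e ?adde0//.
      by apply/max_idPr/ltW; move: wC; rewrite inE.
    apply/max_idPl; rewrite leNgt; apply/negP => h.
    by move/negP: wC; rewrite inE.
  exists kappa'; split.
  - move=> w; rewrite /kappa'; case: ifPn => _.
      by have /andP[h1 h2] := kge w; rewrite h2 (ltnW h1).
    by rewrite leqnn (leq_trans (ltnW kn)).
  - move=> i /andP[ki in_].
    have FCi : F i C by apply: (@FS k i) => //; rewrite ki.
    have [->|ki'] := eqVneq i k.
      rewrite (_ : [set _ | _] = ~` C); first exact: (sigma_setC (sF _)).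
      apply/seteqP; split => w; rewrite /kappa' /=; case: ifPn; rewrite ?inE//.
        by have /andP[h1 h2] := kge w; rewrite leqNgt h1.
      by move=> /negP; rewrite inE.
    have ki1 : (k.+1 <= i <= n)%N by rewrite ltn_neqAle eq_sym ki' ki.
    rewrite (_ : [set _ | _] = ~` C `|` [set w | (kappa w <= i)%N]).
      by apply: (sigma_setU (sF _)); [exact: (sigma_setC (sF _))|exact: kst].
    apply/seteqP; split => w; rewrite /kappa' /=; case: ifPn; rewrite ?inE.
    + by move=> _; right.
    + by move=> /negP; rewrite inE; left.
    + by move=> wC [].
    + by move=> _ _.
  - have Cm : measurable (setT `&` C) by rewrite setTI.
    have Cm' : measurable (setT `\` C) by rewrite setTD; exact: measurableC.
    have h := emeasurable_funD (emeasurable_indicM Cm' (mgZ k (ltnW kn)))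
      (emeasurable_indicM Cm mk).
    apply: (eq_measurable_fun _ _ h) => w _; rewrite -E.
    by rewrite indicT mul1e.
  - move=> A FA.
    have FD : F k (A `\` C) by exact: (sigma_setD (sF _)).
    have FI : F k (A `&` C) by exact: (sigma_setI (sF _)).
    under eq_integral do rewrite E.
    under [RHS]eq_integral do rewrite EV.
    have mD := emeasurable_indicM (mP _ _ FD) (mgZ k (ltnW kn)).
    have mc : measurable_fun setT (fun w => cont j k (Z k w)).
      exact: (measurableT_comp (mcont j k) (mZ (ltnW kn))).
    rewrite ge0_integralD//; last 3 first.
    + by move=> w _; apply: indic_ge0; rewrite lee_fin.
    + by move=> w _; apply: indic_ge0; exact: reward_ge0.
    + by apply: emeasurable_indicM => //; exact: (mP k).
    rewrite ge0_integralD//; last 3 first.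
    + by move=> w _; apply: indic_ge0; rewrite lee_fin.
    + by move=> w _; apply: indic_ge0; exact: cont_ge0.
    + by apply: emeasurable_indicM => //; exact: (mP k).
    congr (_ + _)%E; rewrite kint; last exact: (gc_mono chain kn).
    by apply: (integral_chain_step_on kn) => // z'; exact: bellman_ge0.
have [kappa [kge kst mk kint]] := claim n 0%N (add0n n).
exists kappa; split.
- by move=> w; have /andP[] := kge w.
- by move=> k kn; exact: kst.
have := kint setT (sigma_setT (sF 0)).
under eq_integral do rewrite indicT mul1e.
move=> ->; under eq_integral do rewrite indicT mul1e.
by rewrite (integral_start Z0)// => z'; exact: bellman_ge0.
Qed.

End Chain.

(** * Brownian filtrations and Wiener sums *)

Section Filtrations.
Context {R : realType} {d : measure_display} {Omega : measurableType d}.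
Variables (P : probability Omega R) (W : R -> {RV P >-> R}).
Implicit Types s t : R.

Lemma natural_sigma_algebra t : sigma_algebra setT (natural_filtration W t).
Proof. exact: smallest_sigma_algebra. Qed.

Lemma augmented_sigma_algebra t : sigma_algebra setT (augmented_filtration W t).
Proof. exact: smallest_sigma_algebra. Qed.

Lemma natural_sub t : natural_filtration W t `<=` measurable.
Proof.
apply: smallest_sub; first exact: sigma_algebra_measurable.
move=> _ [s [B [_ _ mB ->]]]; rewrite -[X in measurable X]setTI.
exact: measurable_funPT.
Qed.

Lemma natural_le s t : s <= t -> natural_filtration W s `<=` natural_filtration W t.
Proof.
move=> st; apply: sub_sigma_algebra2 => _ [u [B [u0 us mB ->]]].
by exists u, B; split => //; exact: le_trans st.
Qed.

Lemma augmented_le s t : s <= t ->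
  augmented_filtration W s `<=` augmented_filtration W t.
Proof.
by move=> st; apply: sub_sigma_algebra2; apply: setSU; exact: natural_le.
Qed.

Lemma augmented_sub t : measure_is_complete P ->
  augmented_filtration W t `<=` measurable.
Proof.
move=> hP; apply: smallest_sub; first exact: sigma_algebra_measurable.
by move=> A [/natural_sub//|]; exact: hP.
Qed.

Lemma natural_fmeas s t : 0 <= s -> s <= t -> fmeas (natural_filtration W t) (W s).
Proof.
by move=> s0 st B mB; apply: sub_sigma_algebra; exists s, B.
Qed.

(** The events that differ from a natural one by a null set already form a
    sigma-algebra containing the null sets. *)
Lemma augmented_natural t A : augmented_filtration W t A ->
  exists2 A', natural_filtration W t A' & P.-negligible ((A `\` A') `|` (A' `\` A)).
Proof.
move: A; apply: smallest_sub; last first.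
  move=> A [nA|neg].
    by exists A => //; rewrite setDv setU0; exact: negligible_set0.
  exists set0; first exact: sigma_algebra0.
  by rewrite setD0 set0D setU0.
split.
- exists set0; first exact: sigma_algebra0.
  by rewrite setDv setU0; exact: negligible_set0.
- move=> A [A' nA' neg]; exists (~` A').
    exact: (sigma_setC (natural_sigma_algebra t)).
  rewrite setTD; apply: negligibleS neg => w /= [[nA nA'']|[nA'' nA]].
    by right; split => //; exact: contrapT.
  by left; split => //; exact: contrapT.
- move=> A HA.
  have {HA} /choice[A' H] i : exists A', natural_filtration W t A' /\
      P.-negligible ((A i `\` A') `|` (A' `\` A i)).
    by have [A' ? ?] := HA i; exists A'.
  exists (\bigcup_i A' i).
    by apply: sigma_algebra_bigcup => i; have [] := H i.
  apply: (@negligibleS _ _ _ _ (\bigcup_i ((A i `\` A' i) `|` (A' i `\` A i)))).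
    move=> w /= [[[i _ Ai] nA']|[[i _ Ai] nA]]; exists i => //.
      by left; split => // A'i; apply: nA'; exists i.
    by right; split => // A'i; apply: nA; exists i.
  by apply: negligible_bigcup => i; have [] := H i.
Qed.

Lemma augmented_indep t I (v : R) : measure_is_complete P ->
  measurable_fun setT I ->
  (forall A B, natural_filtration W t A -> measurable B ->
    P (A `&` [set w | B (I w)]) = (P A * normal_prob 0 1 [set y | B (v * y)%R])%E) ->
  forall A B, augmented_filtration W t A -> measurable B ->
    P (A `&` [set w | B (I w)]) = (P A * normal_prob 0 1 [set y | B (v * y)%R])%E.
Proof.
move=> hP mI ind A B FA mB; have [A' nA' neg] := augmented_natural FA.
have mA := augmented_sub hP FA; have mA' := natural_sub nA'.
have mIB : measurable [set w | B (I w)] by rewrite -[X in measurable X]setTI; exact: mI.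
have same C : measurable C -> P (A `&` C) = P (A' `&` C).
  move=> mC; have mneg := hP _ neg; have neg0 := measure_negligible mneg neg.
  set N := _ `|` _ in mneg neg0.
  have cut D : measurable D -> P D = P (D `\` N).
    move=> mD; rewrite -[in LHS](setDUK (A := D `&` N) (B := D)); last by move=> ? [].
    rewrite setDIr setDv set0U measureU//; last 3 first.
    - exact: measurableI.
    - exact: measurableD.
    - by apply/seteqP; split => // w [[_ ?] []].
    rewrite [X in (X + _)%E](_ : _ = 0%E) ?add0e//.
    apply/eqP; rewrite -measure_le0 -neg0; apply: le_measure; rewrite ?inE//.
    exact: measurableI.
  rewrite (cut (A `&` C)) ?(cut (A' `&` C)); try exact: measurableI.
  congr (P _); apply/seteqP; split => w [[Aw Cw] Nw]; split => //; split => //;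
    apply: contrapT => nA; apply: Nw; [left|right]; by [].
by have := same setT measurableT; rewrite !setIT => ->; rewrite same// ind.
Qed.

End Filtrations.

Section WienerSums.
Context {R : realType} {d : measure_display} {Omega : measurableType d}.
Variables (P : probability Omega R) (W : R -> {RV P >-> R}).
Hypothesis hW : standard_brownian_motion W.
Implicit Types (s t : R) (h : R -> \bar R).

Lemma increment_law s t : 0 <= s -> s < t ->
  forall A B, natural_filtration W s A -> measurable B ->
    P (A `&` [set w | B (W t w - W s w)]) =
    (P A * normal_prob 0 1 [set y | B (Num.sqrt (t - s) * y)%R])%E.
Proof.
move=> s0 st A B FA mB; rewrite (sbm_independent hW)//; congr (_ * _)%E.
have sd0 : 0 < Num.sqrt (t - s) by rewrite sqrtr_gt0 subr_gt0.
by rewrite (sbm_gaussian hW s0 st mB) (normal_prob_scale sd0 mB).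
Qed.

Lemma measurable_increment s t : measurable_fun setT (fun w => W t w - W s w).
Proof. by apply: measurable_funB. Qed.

Lemma integral_increment s t h : 0 <= s -> s < t -> measurable_fun setT h ->
  (forall z, 0 <= h z)%E ->
  (\int[P]_w h (W t w - W s w)%R = gstep h 0 (Num.sqrt (t - s)))%E.
Proof.
move=> s0 st mh h0.
have Fc : fmeas (natural_filtration W s) (cst 0 : Omega -> R).
  apply/(fmeasP _ (natural_sigma_algebra W s)); exact: measurable_cst.
have mf : measurable_fun setT (fun p : R * R => h p.2) by exact: measurableT_comp.
have E := integral_indep (@natural_sub _ _ _ _ W s) Fc
  (measurable_increment s t) (increment_law s0 st) mf (fun p => h0 p.2).
exact: (etrans E (integral_probability_cst P (gstep h 0 (Num.sqrt (t - s))))).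
Qed.

(** Gaussian convolution, read off the Brownian motion itself: the increment
    over [0, p^2 + q^2] is the sum of two independent ones. *)
Lemma gstep_gstep h (p q : R) : 0 < p -> 0 < q -> measurable_fun setT h ->
  (forall z, 0 <= h z)%E ->
  gstep (fun y => gstep h y q) 0 p = gstep h 0 (Num.sqrt (p ^+ 2 + q ^+ 2)).
Proof.
move=> p0 q0 mh h0; set u := p ^+ 2; set t := u + q ^+ 2.
have u0 : 0 < u by rewrite exprn_gt0.
have ut : u < t by rewrite ltrDl exprn_gt0.
have t0 : 0 < t by exact: lt_trans ut.
have mg : measurable_fun setT (fun y => gstep h y q).
  apply: (@measurable_gstep_param _ _ R (fun x => h x.2) id (fun=> q)) => //.
  exact: measurableT_comp.
have g0 y : (0 <= gstep h y q)%E by exact: gstep_ge0.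
transitivity (\int[P]_w h (W t w - W 0 w)%R)%E; last first.
  by rewrite integral_increment// subr0.
transitivity (\int[P]_w gstep h (W u w - W 0 w)%R q)%E.
  rewrite [RHS](integral_increment (lexx 0) u0 mg g0).
  by rewrite subr0 sqrtr_sqr gtr0_norm.
have Fz : fmeas (natural_filtration W u) (fun w => W u w - W 0 w).
  apply/(fmeasP _ (natural_sigma_algebra W u)); apply: measurable_funB;
    by apply/(fmeasP _ (natural_sigma_algebra W u)); apply: natural_fmeas => //; exact: ltW.
have mf : measurable_fun setT (fun x : R * R => h (x.1 + x.2)).
  by apply: (measurableT_comp mh); exact: measurable_funD.
have E := integral_indep (@natural_sub _ _ _ _ W u) Fz
  (measurable_increment u t) (increment_law (ltW u0) ut) mf (fun p => h0 _).
transitivity (\int[P]_w h (W u w - W 0 w + (W t w - W u w))%R)%E; last first.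
  by apply: eq_integral => w _; congr h; ring.
rewrite E; apply: eq_integral => w _; rewrite /t addrAC subrr add0r sqrtr_sqr gtr0_norm//.
by apply: eq_integral => y _; rewrite add0r.
Qed.

Definition wiener_sum (u c : nat -> R) (m : nat) (w : Omega) : R :=
  \sum_(i < m) c i * (W (u i.+1) w - W (u i) w).

Lemma wiener_sumS u c m w : wiener_sum u c m.+1 w =
  wiener_sum u c m w + c m * (W (u m.+1) w - W (u m) w).
Proof. by rewrite /wiener_sum big_ord_recr. Qed.

Lemma measurable_wiener_sum u c m : measurable_fun setT (wiener_sum u c m).
Proof.
apply: measurable_sum => i; apply: measurable_funM => //.
exact: measurable_increment.
Qed.

(** Each step adds an independent Gaussian variable, so the variances
    [c_i^2 (u_{i+1} - u_i)] add up; [\1_A] records independence of the past. *)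
Lemma integral_wiener_sum (u c : nat -> R) A m h :
  0 <= u 0%N -> (forall i, u i < u i.+1) ->
  (forall i, (i <= m)%N -> 0 < c i) ->
  natural_filtration W (u 0%N) A -> measurable_fun setT h ->
  (forall z, 0 <= h z)%E ->
  (\int[P]_w ((\1_A w)%:E * h (wiener_sum u c m.+1 w)) =
   P A * gstep h 0
     (Num.sqrt (\sum_(i < m.+1) c i ^+ 2 * (u i.+1 - u i))))%E.
Proof.
move=> u0 uS + FA.
have uge i j : (i <= j)%N -> u i <= u j.
  by move=> ij; apply: (homo_leq (r := <=%R)) ij => //;
    [exact: le_trans|move=> k; exact: ltW].
have ui0 i : 0 <= u i by exact: le_trans (uge 0%N i _).
pose q i := c i * Num.sqrt (u i.+1 - u i).
have q0 i : 0 < c i -> 0 < q i.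
  by move=> ci0; rewrite mulr_gt0// sqrtr_gt0 subr_gt0.
have q2 i : q i ^+ 2 = c i ^+ 2 * (u i.+1 - u i).
  by rewrite exprMn sqr_sqrtr// subr_ge0 ltW.
have step i h' : measurable_fun setT h' -> (forall z, 0 <= h' z)%E ->
    (\int[P]_w ((\1_A w)%:E * h' (wiener_sum u c i.+1 w)) =
     \int[P]_w ((\1_A w)%:E * gstep h' (wiener_sum u c i w) (q i)))%E.
  move=> mh' h'0.
  have mA : measurable A by exact: natural_sub FA.
  have sF := natural_sigma_algebra W (u i).
  have FA' : fmeas (natural_filtration W (u i)) (\1_A : Omega -> R).
    apply/(fmeasP _ sF); apply: measurable_indic.
    by rewrite (sigma_algebra_measurableE sF); exact: (natural_le (uge _ _ (leq0n i)) FA).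
  have FS : fmeas (natural_filtration W (u i)) (wiener_sum u c i).
    apply/(fmeasP _ sF); apply: measurable_sum => k; apply: measurable_funM => //.
    apply: measurable_funB; apply/(fmeasP _ sF); apply: natural_fmeas => //;
      apply: uge => //; exact: ltnW.
  have FZ : fmeas (natural_filtration W (u i)) (fun w => (\1_A w : R, wiener_sum u c i w)).
    by apply/(fmeasP _ sF); apply: measurable_fun_pair; exact/(fmeasP _ sF).
  have mf : measurable_fun setT (fun p : R * R * R => `|p.1.1|%:E * h' (p.1.2 + c i * p.2)%R)%E.
    apply: emeasurable_funM.
      apply/measurable_EFinP; apply: measurableT_comp => //.
      exact: measurableT_comp.
    apply: (measurableT_comp mh'); apply: measurable_funD.
      exact: measurableT_comp.
    by apply: measurable_funM.
  have := integral_indep (@natural_sub _ _ _ _ W (u i)) FZ (measurable_increment (u i) (u i.+1))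
    (increment_law (ui0 i) (uS i)) mf _.
  rewrite /= => E; transitivity (\int[P]_w (`|\1_A w : R|%:E *
      h' (wiener_sum u c i w + c i * (W (u i.+1) w - W (u i) w))%R))%E.
    by apply: eq_integral => w _; rewrite wiener_sumS ger0_norm.
  rewrite E; last by move=> p; rewrite mule_ge0.
  apply: eq_integral => w _; rewrite /gstep.
  rewrite ge0_integralZl//; last first.
    have maff := measurableT_comp mh' (measurable_affine (wiener_sum u c i w) (q i)).
    by apply: (eq_measurable_fun _ _ maff) => y _ /=; rewrite add0r /q mulrA.
  rewrite ger0_norm//; congr (_ * _)%E; apply: eq_integral => y _.
  by rewrite add0r /q mulrA.
elim: m h => [|m IH] h c0 mh h0.
  rewrite step// big_ord1 -q2 sqrtr_sqr (gtr0_norm (q0 _ (c0 0%N _)))//.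
  under eq_integral do rewrite {1}/wiener_sum big_ord0.
  rewrite ge0_integralZr//; last by apply: gstep_ge0.
    by rewrite integral_indic ?setIT//; exact: natural_sub FA.
  apply/measurable_EFinP; apply: measurable_indic; exact: natural_sub FA.
have {}q0 i : (i <= m.+1)%N -> 0 < q i by move=> /c0; exact: q0.
rewrite step// (IH (fun y => gstep h y (q m.+1))); last 3 first.
- by move=> i im; apply: c0; exact: leqW.
- apply: (@measurable_gstep_param _ _ R (fun x => h x.2) id (fun=> q m.+1)) => //.
  exact: measurableT_comp.
- by move=> z; exact: gstep_ge0.
congr (_ * _)%E; rewrite gstep_gstep ?q0//.
  rewrite sqr_sqrtr ?q2; first by rewrite [in RHS]big_ord_recr.
  by apply: sumr_ge0 => i _; rewrite -q2 sqr_ge0.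
rewrite sqrtr_gt0 big_ord_recl -q2 ltr_wpDr ?exprn_gt0 ?q0//.
by apply: sumr_ge0 => i _; rewrite -q2 sqr_ge0.
Qed.

End WienerSums.

(** * Pathwise analysis of the bridge equation *)

Section Path.
Context {R : realType}.
Local Notation mu := (@lebesgue_measure R).
Implicit Types (f x w : R -> R) (a b s t : R).

Lemma within_continuous_eps f (A : set R) : {within A, continuous f} ->
  forall p (e : R), A p -> 0 < e ->
  exists2 dl, 0 < dl & forall q, A q -> `|p - q| < dl -> `|f p - f q| < e.
Proof.
move=> /subspace_continuousP cf p e Ap e0.
have /cvgrPdist_lt/(_ e e0) := cf p Ap.
rewrite near_withinE => /nbhs_ballP[dl /= dl0 H].
by exists dl => // q Aq pq; apply: H.
Qed.

(** Heine's theorem, as a near-covering property of the compact interval. *)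
Lemma uniform_continuity_itv f a b : {within `[a, b], continuous f} ->
  forall e, 0 < e -> exists2 dl, 0 < dl & forall p q,
    p \in `[a, b] -> q \in `[a, b] -> `|p - q| < dl -> `|f p - f q| < e.
Proof.
move=> cf e e0.
have /compact_near_coveringP := @segment_compact R a b.
move=> /(_ R (0%R : R)^'+ (fun dl p => p \in `[a, b] -> forall q, q \in `[a, b] ->
  `|p - q| < dl -> `|f p - f q| < e)) H.
near (0%R : R)^'+ => dl.
have dl0 : 0 < dl by near: dl; exact: nbhs_right_gt.
exists dl => // p q pab qab; suff: p \in `[a, b] -> forall q, q \in `[a, b] ->
  `|p - q| < dl -> `|f p - f q| < e by move=> /(_ pab _ qab).
suff: `[a, b]%classic `<=` (fun p => p \in `[a, b] -> forall q, q \in `[a, b] ->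
  `|p - q| < dl -> `|f p - f q| < e) by move=> /(_ _ pab).
near: dl; apply: H => {}p pab.
have e2 : 0 < e / 2 by rewrite divr_gt0.
have [dl dl0 Hdl] := within_continuous_eps cf pab e2.
exists (ball p (dl / 2), [set x : R | x < dl / 2]); first split.
- by apply: nbhsx_ballx; rewrite divr_gt0.
- by near=> z; near: z; apply: nbhs_right_lt; rewrite divr_gt0.
move=> [p' dl'] /= [pp' dl'lt] p'ab q qab p'q.
rewrite -(subrKA (f p)) (le_lt_trans (ler_normD _ _))//.
rewrite [e]splitr ltrD//.
  rewrite distrC; apply: Hdl => //.
  by apply: lt_trans pp' _; rewrite ltr_pdivrMr// ltr_pMr// ltr1n.
apply: Hdl => //; rewrite -(subrKA p') (le_lt_trans (ler_normD _ _))//.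
by rewrite [dl]splitr ltrD//; exact: lt_trans dl'lt.
Unshelve. all: by end_near. Qed.

(** Between [u] and [v] the function lies between the constants [f u - e] and
    [f u + e]. *)
Lemma integral_oscillation f t s u v e : t <= u -> u <= v -> v <= s ->
  {within `[t, s], continuous f} ->
  (forall r, r \in `[u, v] -> `|f r - f u| <= e) ->
  `|\int[mu]_(r in `[t, v]) f r - \int[mu]_(r in `[t, u]) f r - (v - u) * f u|
  <= (v - u) * e.
Proof.
move=> tu uv vs cf osc.
have cint A : compact A -> A `<=` `[t, s]%classic -> mu.-integrable A (EFin \o f).
  by move=> cA At; apply: continuous_compact_integrable => //; apply: continuous_subspaceW cf.
have itv : mu.-integrable `[t, v] (EFin \o f).
  apply: cint; first exact: segment_compact.
  by apply: subset_itvl; rewrite bnd_simp.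
have iuv : mu.-integrable `]u, v] (EFin \o f).
  apply: integrableS itv => //.
  by move=> r /=; rewrite !in_itv /= => /andP[ur ->]; rewrite (le_trans tu (ltW ur)).
rewrite Rintegral_itvB// ?bnd_simp//.
have icst (c : R) : mu.-integrable `]u, v] (EFin \o cst c).
  have icc : mu.-integrable `[u, v] (EFin \o cst c).
    apply: continuous_compact_integrable; first exact: segment_compact.
    by move=> r; exact: cvg_cst.
  apply: integrableS icc => // r /=.
  by rewrite !in_itv /= => /andP[/ltW-> ->].
have muuv : fine (mu `]u, v]) = v - u.
  rewrite lebesgue_measure_itv /= lte_fin.
  by case: ltP => [//|vu]; apply/esym/eqP; rewrite subr_eq0 eq_le uv vu.
have lo : (v - u) * (f u - e) <= \int[mu]_(r in `]u, v]) f r.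
  rewrite mulrC -muuv -Rintegral_cst//; apply: le_Rintegral => //; first exact: icst.
  move=> r /=.
  rewrite in_itv /= => /andP[ur rv].
  have := osc r; rewrite in_itv /= (ltW ur) rv => /(_ isT).
  by rewrite ler_norml => /andP[]; lra.
have hi : \int[mu]_(r in `]u, v]) f r <= (v - u) * (f u + e).
  rewrite mulrC -muuv -Rintegral_cst//; apply: le_Rintegral => //; first exact: icst.
  move=> r /=.
  rewrite in_itv /= => /andP[ur rv].
  have := osc r; rewrite in_itv /= (ltW ur) rv => /(_ isT).
  by rewrite ler_norml => /andP[]; lra.
move: lo hi; move: (\int[mu]_(r in _) _) (f u) => I fu lo hi.
by rewrite ler_norml; apply/andP; split; lra.
Qed.

Definition grid s s' (m : nat) (i : nat) : R := s + (s' - s) * (i%:R / m.+1%:R).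

(** The integrand [1 / (1 - u)] of the bridge, sampled at the geometric mean
    of the values at both ends of a step: the variance [c^2 * (v - u)] of a
    step is then exactly the increment of [1 / (1 - u)]. *)
Definition bridge_weight (u v : R) : R := (Num.sqrt ((1 - u) * (1 - v)))^-1.

Lemma bridge_weight_var u v : u < 1 -> v < 1 ->
  bridge_weight u v ^+ 2 * (v - u) = (1 - v)^-1 - (1 - u)^-1.
Proof.
move=> u1 v1; rewrite exprVn sqr_sqrtr; last by rewrite mulr_ge0// subr_ge0 ltW.
by field; rewrite !subr_eq0 !gt_eqF.
Qed.

Lemma bridge_weight_near u v (k : R) : u <= v -> v < 1 -> (1 - v)^-1 <= k ->
  `|(1 - v)^-1 - bridge_weight u v| <= k ^+ 2 * (v - u).
Proof.
move=> uv v1 vk.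
have u1 : u < 1 by exact: le_lt_trans v1.
have [p0 q0] : 0 < 1 - u /\ 0 < 1 - v by rewrite !subr_gt0.
have qp : 1 - v <= 1 - u by rewrite lerD2l lerN2.
set p := 1 - u in p0 qp *; set q := 1 - v in q0 qp vk *.
have weight_lo : p^-1 <= bridge_weight u v.
  rewrite lef_pV2 ?posrE ?sqrtr_gt0 ?mulr_gt0//.
  by rewrite -[leRHS]gtr0_norm// -sqrtr_sqr ler_sqrt ?sqr_ge0// expr2 ler_wpM2l// ltW.
have weight_hi : bridge_weight u v <= q^-1.
  rewrite lef_pV2 ?posrE ?sqrtr_gt0 ?mulr_gt0//.
  rewrite -[leLHS]gtr0_norm// -sqrtr_sqr ler_sqrt; first by rewrite expr2 ler_wpM2r// ltW.
  by rewrite mulr_ge0// ltW.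
rewrite ger0_norm ?subr_ge0//; apply: (@le_trans _ _ (q^-1 - p^-1)); first by rewrite lerD2l lerN2.
have -> : q^-1 - p^-1 = p^-1 * q^-1 * (v - u).
  by rewrite /p /q; field; rewrite !gt_eqF.
rewrite ler_wpM2r ?subr_ge0// expr2 ler_pM ?invr_ge0 ?(ltW p0) ?(ltW q0)//.
by rewrite (le_trans _ vk)// lef_pV2.
Qed.

(** The factor [1 / (1 - u)] compensates the drift: in the increment of
    [x / (1 - u)] it leaves only the difference between [x / (1 - u)] and its
    mean over the step, which is an oscillation times the length of the step. *)
Lemma bridge_step x w t s u v k (e x0 : R) :
  t <= u -> u <= v -> v <= s -> s < 1 -> (1 - s)^-1 <= k ->
  {within `[t, s], continuous (fun r => x r / (1 - r))} ->
  (forall r, t <= r -> r <= s ->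
     x r = x0 - \int[mu]_(y in `[t, r]) (x y / (1 - y)) + (w r - w t)) ->
  (forall r, r \in `[u, v] -> `|x r / (1 - r) - x u / (1 - u)| <= e) ->
  `|w v - w u| <= e ->
  `|(x v / (1 - v) - x u / (1 - u)) - bridge_weight u v * (w v - w u)| <=
    (k + k ^+ 2) * e * (v - u).
Proof.
move=> tu uv vs s1 sk cM sde oscM oscw.
have v1 : v < 1 by exact: le_lt_trans s1.
have u1 : u < 1 by exact: le_lt_trans v1.
have [p0 q0] : 0 < 1 - u /\ 0 < 1 - v by rewrite !subr_gt0.
have vk : (1 - v)^-1 <= k.
  by apply: le_trans sk; rewrite lef_pV2 ?posrE ?subr_gt0// lerD2l lerN2.
have := bridge_weight_near uv v1 vk; set c := bridge_weight u v => ck.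
have := integral_oscillation tu uv vs cM oscM.
set I := (X in X - _) => hI.
have xvu : x v - x u = - I + (w v - w u).
  rewrite (sde v) ?(le_trans tu)// (sde u) ?(le_trans uv)// /I; ring.
have -> : x v / (1 - v) - x u / (1 - u) - c * (w v - w u) =
    ((1 - v)^-1 - c) * (w v - w u) - (1 - v)^-1 * (I - (v - u) * (x u / (1 - u))).
  have -> : I = (w v - w u) - (x v - x u) by rewrite xvu; ring.
  by field; rewrite !gt_eqF.
apply: (le_trans (ler_normB _ _)); rewrite !normrM.
have -> : (k + k ^+ 2) * e * (v - u) =
    k ^+ 2 * (v - u) * e + k * ((v - u) * e) by ring.
apply: lerD; first by rewrite ler_pM.
by rewrite ler_pM// ger0_norm// invr_ge0 ltW.
Qed.

End Path.

Section RiemannSums.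
Context {R : realType}.
Local Notation mu := (@lebesgue_measure R).
Implicit Types (f x w : R -> R) (a b s t : R).

Lemma grid0 s s' m : grid s s' m 0 = s.
Proof. by rewrite /grid mul0r mulr0 addr0. Qed.

Lemma grid_last s s' m : grid s s' m m.+1 = s'.
Proof. by rewrite /grid divff ?pnatr_eq0// mulr1 addrC subrK. Qed.

Lemma gridS s s' m i : grid s s' m i.+1 - grid s s' m i = (s' - s) / m.+1%:R.
Proof. by rewrite /grid -natr1; ring. Qed.

Lemma grid_lt s s' m i : s < s' -> grid s s' m i < grid s s' m i.+1.
Proof. by move=> ss; rewrite -subr_gt0 gridS divr_gt0// subr_gt0. Qed.

Lemma grid_homo s s' m i j : s < s' -> (i <= j)%N -> grid s s' m i <= grid s s' m j.
Proof.
move=> ss ij; apply: (homo_leq (r := <=%R)) ij => //; first exact: le_trans.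
by move=> k; apply/ltW/grid_lt.
Qed.

(** The errors of [bridge_step] add up to a multiple of the oscillations of
    [x / (1 - u)] and of the driving path over one step of the grid. *)
Lemma bridge_riemann x w t s s' (x0 : R) : t <= s -> s < s' -> s' < 1 ->
  {within `[t, s'], continuous x} -> {within `[t, s'], continuous w} ->
  (forall r, t <= r -> r <= s' ->
     x r = x0 - \int[mu]_(y in `[t, r]) (x y / (1 - y)) + (w r - w t)) ->
  \sum_(i < m.+1) bridge_weight (grid s s' m i) (grid s s' m i.+1) *
     (w (grid s s' m i.+1) - w (grid s s' m i)) @[m --> \oo] -->
  x s' / (1 - s') - x s / (1 - s).
Proof.
move=> ts ss s1 cx cw sde.
have cM : {within `[t, s'], continuous (fun r => x r / (1 - r))}.
  apply/subspace_continuousP => r rts; apply: cvgM.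
    by move/subspace_continuousP : cx; exact.
  have r1 : 1 - r != 0.
    by move: rts; rewrite /= in_itv /= subr_eq0 => /andP[_ rs]; rewrite gt_eqF// (le_lt_trans rs).
  apply: cvg_within_filter; apply: cvgV => //; apply: cvgB; [exact: cvg_cst|exact: cvg_id].
set k := (1 - s')^-1.
have k0 : 0 < k by rewrite invr_gt0 subr_gt0.
pose K := (k + k ^+ 2) * (s' - s) + 1.
have K0 : 0 < K by rewrite ltr_wpDl// mulr_ge0 ?subr_ge0 ?ltW// addr_gt0 ?exprn_gt0.
apply/cvgrPdist_lt => eps eps0; pose e := eps / K.
have e0 : 0 < e by rewrite divr_gt0.
have [d1 d10 H1] := uniform_continuity_itv cM e0.
have [d2 d20 H2] := uniform_continuity_itv cw e0.
have small : \forall m \near \oo, (s' - s) / m.+1%:R < Num.min d1 d2.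
  near=> m; rewrite ltr_pdivrMr// -ltr_pdivrMl ?lt_min ?d10//.
  near: m; exists (Num.truncn ((Num.min d1 d2)^-1 * (s' - s))) => // m /= hm.
  apply: (lt_le_trans (truncnS_gt _)); rewrite ler_nat.
  by rewrite ltnS.
near=> m.
have : (s' - s) / m.+1%:R < Num.min d1 d2 by near: m.
rewrite lt_min => /andP[step1 step2].
have gin i : (i <= m.+1)%N -> grid s s' m i \in `[t, s'].
  move=> im; have := grid_homo m ss im; have := grid_homo m ss (leq0n i).
  by rewrite grid0 grid_last in_itv /= => si ->; rewrite (le_trans ts si).
set M := fun r => x r / (1 - r).
have tele : M s' - M s = \sum_(i < m.+1) (M (grid s s' m i.+1) - M (grid s s' m i)).
  rewrite -(big_mkord predT (fun i => M (grid s s' m i.+1) - M (grid s s' m i))).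
  by rewrite telescope_sumr// grid0 grid_last.
rewrite -/(M s') -/(M s) tele -sumrB.
apply: (le_lt_trans (ler_norm_sum _ _ _)).
apply: (@le_lt_trans _ _ (\sum_(i < m.+1) ((k + k ^+ 2) * e * ((s' - s) / m.+1%:R)))).
  apply: ler_sum => i _.
  have gi := gin i (ltnW (ltn_ord i)); have gi1 := gin i.+1 (ltn_ord i).
  have := gi; have := gi1; rewrite !in_itv /= => /andP[ti1 si1] /andP[ti si].
  have ii := ltW (grid_lt m i ss).
  rewrite -(gridS s s' m i); apply: (@bridge_step _ x w t s' _ _ k e x0) => //.
    move=> r; rewrite in_itv /= => /andP[ir ri].
    have rts : r \in `[t, s'].
      by rewrite in_itv /= (le_trans ti ir) (le_trans ri si1).
    rewrite distrC; apply/ltW/H1 => //.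
    rewrite distrC ger0_norm ?subr_ge0//.
    by apply: le_lt_trans step1; rewrite -(gridS s s' m i) lerD2r.
  rewrite distrC; apply/ltW/H2 => //.
  by rewrite distrC gridS ger0_norm// divr_ge0// subr_ge0 ltW.
rewrite sumr_const card_ord.
have -> : (k + k ^+ 2) * e * ((s' - s) / m.+1%:R) *+ m.+1 =
    eps * ((k + k ^+ 2) * (s' - s) / K).
  rewrite -mulr_natr /e; have : m.+1%:R != 0 :> R by rewrite pnatr_eq0.
  by move: (m.+1%:R : R) => n n0; field; rewrite n0 gt_eqF.
by rewrite gtr_pMr// ltr_pdivrMr// mul1r /K ltrDl.
Unshelve. all: by end_near. Qed.

End RiemannSums.

(** * Passage to the limit in the law of Wiener sums *)

Section LimitLaw.
Context {R : realType} {d : measure_display} {Omega : measurableType d}.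
Variable P : probability Omega R.

(** Continuous approximation from below of the indicator of [`]c, +oo[]. *)
Definition ramp (c : R) (k : nat) (y : R) : R := Num.min 1 (Num.max 0 (k%:R * (y - c))).

Lemma ramp_ge0 c k y : 0 <= ramp c k y.
Proof. by rewrite le_min ler01 le_max lexx. Qed.

Lemma ramp_le1 c k y : ramp c k y <= 1.
Proof. by rewrite ge_min lexx. Qed.

Lemma ramp_homo c y : {homo (ramp c)^~ y : k l / (k <= l)%N >-> k <= l}.
Proof.
move=> k l kl; rewrite /ramp le_min ge_min lexx /= ge_min; apply/orP; right.
rewrite ge_max !le_max lexx /=; case: (leP 0 (y - c)) => yc.
  by rewrite ler_wpM2r ?orbT// ler_nat.
by rewrite mulr_ge0_le0// ltW.
Qed.

Lemma continuous_ramp c k : continuous (ramp c k).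
Proof.
move=> y.
apply: (@continuous_min _ _ (cst 1 : R -> R^o) (fun y => Num.max 0 (k%:R * (y - c)) : R^o)).
  exact: cvg_cst.
apply: (@continuous_max _ _ (cst 0 : R -> R^o) (fun y => k%:R * (y - c) : R^o)).
  exact: cvg_cst.
apply: cvgM; first exact: cvg_cst.
by apply: cvgB; [exact: cvg_id|exact: cvg_cst].
Qed.

Lemma cvg_ramp (c y : R) :
  ramp c k y @[k --> \oo] --> (\1_(`]c, +oo[%classic) y : R).
Proof.
rewrite indicE (_ : (y \in _) = (c < y)); last first.
  by apply/idP/idP; rewrite inE /= in_itv /= andbT.
have [yc|yc] := ltP c y.
  apply: (cvg_near_cst (1 : R)); near=> k; apply/min_idPl.
  rewrite le_max; apply/orP; right; rewrite -ler_pdivrMr ?subr_gt0// mul1r.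
  near: k; exists (Num.truncn ((y - c)^-1)).+1 => // k /= hk.
  by apply/ltW; apply: (lt_le_trans (truncnS_gt _)); rewrite ler_nat.
apply: (cvg_near_cst (0 : R)); near=> k; rewrite /ramp (_ : Num.max _ _ = 0) ?(min_idPr _)//.
by apply/max_idPl; rewrite mulr_ge0_le0// subr_le0.
Unshelve. all: by end_near. Qed.

(** The sums [S m] all have the same law on [A]. Dominated convergence passes to
    the limit for continuous ramps, monotone convergence reaches the rays, and
    these determine a measure. *)
Lemma limit_law (A : set Omega) (S : nat -> Omega -> R) (I : Omega -> R) (v : R) :
  measurable A -> (forall m, measurable_fun setT (S m)) -> measurable_fun setT I ->
  {ae P, forall w, S m w @[m --> \oo] --> I w} ->
  (forall m (h : R -> \bar R), measurable_fun setT h -> (forall z, 0 <= h z)%E ->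
    (\int[P]_w ((\1_A w)%:E * h (S m w)) = P A * gstep h 0 v)%E) ->
  forall B, measurable B ->
    P (A `&` [set w | B (I w)]) = (P A * normal_prob 0 1 [set y | B (v * y)%R])%E.
Proof.
move=> mA mS mI SI law.
have mr c k : measurable_fun setT (ramp c k).
  by apply: continuous_measurable_fun; exact: continuous_ramp.
have mA1 : measurable_fun setT (fun w => (\1_A w)%:E : \bar R).
  by apply/measurable_EFinP; exact: measurable_indic.
have mrE c k (J : Omega -> R) : measurable_fun setT J ->
    measurable_fun setT (fun w => (\1_A w)%:E * (ramp c k (J w))%:E)%E.
  move=> mJ; apply: emeasurable_funM => //; apply/measurable_EFinP.
  exact: (measurableT_comp (mr c k) mJ).
have rampI c k : (\int[P]_w ((\1_A w)%:E * (ramp c k (I w))%:E) =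
    P A * gstep (EFin \o ramp c k) 0 v)%E.
  have [] := @dominated_convergence _ _ _ P setT measurableT
    (fun m w => (\1_A w)%:E * (ramp c k (S m w))%:E)%E
    (fun w => (\1_A w)%:E * (ramp c k (I w))%:E)%E (cst 1%E).
  - by move=> m; exact: mrE.
  - exact: mrE.
  - move: SI; apply: filterS => w cw _; under eq_fun do rewrite -EFinM.
    rewrite -EFinM; apply/cvg_EFin; first by near=> m.
    apply: cvgM; first exact: cvg_cst.
    by apply: continuous_cvg => //; exact: continuous_ramp.
  - exact: finite_measure_integrable_cst.
  - apply: aeW => w m _; rewrite -EFinM /= lee_fin ger0_norm ?mulr_ge0 ?ramp_ge0//.
    by rewrite mulr_ile1 ?ramp_ge0 ?ramp_le1// indicE; case: (_ \in _).
  move=> _ _ lim.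
  have := law; move=> /(_ _ (EFin \o ramp c k)) lawk.
  have E : (fun m => \int[P]_w ((\1_A w)%:E * (ramp c k (S m w))%:E))%E =
      cst (P A * gstep (EFin \o ramp c k) 0 v)%E.
    apply/funext => m; apply: lawk; first exact/measurable_EFinP.
    by move=> z; rewrite lee_fin ramp_ge0.
  by move: lim; rewrite E => /cvg_lim <-//; rewrite lim_cst.
have ray c : P (A `&` [set w | `]c, +oo[%classic (I w)]) =
    (P A * normal_prob 0 1 [set y | `]c, +oo[%classic (v * y)%R])%E.
  have mv : measurable_fun setT (fun y : R => v * y) by exact: measurable_funM.
  have mIc : measurable [set w | `]c, +oo[%classic (I w)].
    by rewrite -[X in measurable X]setTI; exact: mI.
  have mvc : measurable [set y | `]c, +oo[%classic (v * y)].
    by rewrite -[X in measurable X]setTI; exact: mv.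
  have L : (\int[P]_w ((\1_A w)%:E * (ramp c k (I w))%:E))%E @[k --> \oo] -->
      P (A `&` [set w | `]c, +oo[%classic (I w)]).
    have -> : P (A `&` [set w | `]c, +oo[%classic (I w)]) =
        (\int[P]_w limn (fun k => (\1_A w)%:E * (ramp c k (I w))%:E))%E.
      transitivity (\int[P]_w (\1_(A `&` [set w | `]c, +oo[%classic (I w)]) w)%:E)%E.
        by rewrite integral_indic ?setIT//; exact: measurableI.
      apply: eq_integral => w _; apply/esym/cvg_lim => //.
      have -> : \1_(A `&` [set w0 | `]c, +oo[%classic (I w0)]) w =
          \1_A w * \1_(`]c, +oo[%classic) (I w) :> R.
        by rewrite !indicE in_setI -natrM mulnb.
      under eq_fun do rewrite -EFinM.
      apply/cvg_EFin; first by near=> m.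
      by apply: cvgM; [exact: cvg_cst|exact: cvg_ramp].
    apply: cvg_monotone_convergence => //.
    - by move=> k; exact: mrE.
    - by move=> k w _; rewrite mule_ge0 ?lee_fin ?ramp_ge0.
    - move=> w _ k l kl; rewrite lee_wpmul2l ?lee_fin//; exact: ramp_homo.
  have L' : gstep (EFin \o ramp c k) 0 v @[k --> \oo] -->
      normal_prob 0 1 [set y | `]c, +oo[%classic (v * y)].
    have mrv k : measurable_fun setT (fun y : R => (ramp c k (0 + v * y))%:E).
      by apply/measurable_EFinP; exact: (measurableT_comp (mr c k) (measurable_affine 0 v)).
    have -> : normal_prob 0 1 [set y | `]c, +oo[%classic (v * y)] =
        (\int[normal_prob (0:R) 1]_y limn (fun k => (ramp c k (0 + v * y))%:E))%E.
      transitivity (\int[normal_prob (0:R) 1]_y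
          (\1_[set y | `]c, +oo[%classic (v * y)] y)%:E)%E.
        by rewrite integral_indic ?setIT.
      apply: eq_integral => y _; apply/esym/cvg_lim => //.
      rewrite (_ : \1__ y = \1_(`]c, +oo[%classic) (0 + v * y))//; last first.
        by rewrite add0r !indicE.
      by apply/cvg_EFin; [near=> m|exact: cvg_ramp].
    apply: cvg_monotone_convergence => //.
    - by move=> k y _; rewrite lee_fin ramp_ge0.
    - by move=> y _ k l kl; rewrite lee_fin; exact: ramp_homo.
  have := L; under eq_fun do rewrite rampI.
  have PA : P A \is a fin_num by exact: fin_num_measure.
  move=> /cvg_lim <-//; apply/cvg_lim => //.
  exact: cvgeZl.
move=> B mB.
have mIC C : measurable C -> measurable [set w | C (I w)].
  by move=> mC; rewrite -[X in measurable X]setTI; exact: mI.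
have PA0 : 0 <= fine (P A) by exact: fine_ge0.
have mv : measurable_fun setT (fun y : R => v * y) by exact: measurable_funM.
pose m1 := image_measure (mrestr P mA) mI.
pose m2 := mscale (NngNum PA0) (image_measure (normal_prob (0:R) 1) mv).
have m2E C : m2 C = (P A * normal_prob 0 1 [set y | C (v * y)%R])%E.
  by rewrite /m2 /mscale /= fineK//; exact: fin_num_measure.
have m1E C : m1 C = P (A `&` [set w | C (I w)]) by rewrite setIC.
rewrite -m1E -m2E.
apply: (measure_unique (@RGenOInfty.G R) (fun k => `](- k%:R), +oo[%classic)) => //.
- exact: RGenOInfty.measurableE.
- move=> _ _ [a ->] [b ->]; exists (Num.max a b).
  by apply/seteqP; split => y /=; rewrite !in_itv /= !andbT gt_max; [case=> -> ->|case/andP].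
- by move=> i; exists (- i%:R).
- apply/seteqP; split => // y _; exists (Num.truncn `|y|).+1 => //=.
  rewrite in_itv /= andbT ltrNl (le_lt_trans _ (truncnS_gt `|y|))//.
  by rewrite -normrN ler_norm.
- by move=> _ [c ->]; exact: (etrans (m1E _) (etrans (ray c) (esym (m2E _)))).
- by move=> k; rewrite m1E; apply: le_lt_trans (probability_le1 P _) _; rewrite ?ltry//;
    by apply: measurableI => //; exact: mIC.
Unshelve. all: by end_near. Qed.

End LimitLaw.

(** * The law of the bridge *)

Section BridgeLaw.
Context {R : realType} {d : measure_display} {Omega : measurableType d}.
Variables (P : probability Omega R) (W : R -> {RV P >-> R}).
Hypothesis hP : measure_is_complete P.
Hypothesis hW : standard_brownian_motion W.
Variables (t x : R) (X : R -> Omega -> R).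
Hypotheses (t0 : 0 <= t) (t1 : t < 1) (hX : brownian_bridge W t x X).

Lemma bridge_measurable s : t <= s -> s <= 1 -> measurable_fun setT (X s).
Proof.
move=> ts s1; apply: (fmeas_measurable (augmented_sub hP)).
exact: (bb_adapted hX).
Qed.

Lemma bridge_start : {ae P, forall w, X t w = x}.
Proof.
move: (bb_sde hX); apply: filterS => w /(_ t (lexx t) t1) ->.
by rewrite set_itv1 Rintegral_set1 subr0 subrr addr0.
Qed.

(** [X / (1 - s)] is a Wiener integral: its Riemann sums have the exact variance
    [(1 - s')^-1 - (1 - s)^-1] by the choice of the weights, whatever the mesh,
    and converge to its increment on almost every path. *)
Lemma bridge_increment_law s s' : t <= s -> s < s' -> s' < 1 ->
  forall A B, augmented_filtration W s A -> measurable B ->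
  P (A `&` [set w | B (X s' w / (1 - s') - X s w / (1 - s))]) =
  (P A * normal_prob 0 1
     [set y | B (Num.sqrt ((1 - s')^-1 - (1 - s)^-1) * y)%R])%E.
Proof.
move=> ts ss s1; have s_lt1 := lt_trans ss s1.
have mI : measurable_fun setT (fun w => X s' w / (1 - s') - X s w / (1 - s)).
  apply: measurable_funB; apply: measurable_funM => //; apply: bridge_measurable => //.
  - by rewrite (le_trans ts)// ltW.
  - exact: ltW.
  - exact: ltW.
apply: (augmented_indep hP mI) => A B FA mB.
pose c m i := bridge_weight (grid s s' m i) (grid s s' m i.+1).
have grid1 m i : (i <= m.+1)%N -> grid s s' m i < 1.
  move=> im; apply: le_lt_trans s1; rewrite -[leRHS](grid_last s s' m).
  exact: grid_homo.
apply: (@limit_law _ _ _ P A (fun m => wiener_sum W (grid s s' m) (c m) m.+1)) => //.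
- exact: natural_sub FA.
- by move=> m; exact: measurable_wiener_sum.
- move: (bb_continuous hX) (sbm_continuous hW) (bb_sde hX).
  apply: filterS3 => w cX cW sde.
  apply: (@bridge_riemann _ (fun r => X r w) (fun r => W r w) t s s' x) => //.
  + apply: continuous_subspaceW cX => r /=; rewrite !in_itv /= => /andP[-> rs].
    exact: le_lt_trans s1.
  + apply: continuous_subspaceW cW => r /=; rewrite !in_itv /= andbT => /andP[tr _].
    exact: le_trans tr.
  + by move=> r tr rs; apply: sde => //; exact: le_lt_trans s1.
move=> m h mh h0; rewrite integral_wiener_sum//.
- congr (_ * gstep _ _ (Num.sqrt _))%E.
  transitivity (\sum_(0 <= i < m.+1) ((1 - grid s s' m i.+1)^-1 - (1 - grid s s' m i)^-1)).
    rewrite big_mkord; apply: eq_bigr => i _; rewrite bridge_weight_var//.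
      by apply: grid1; exact: ltnW.
    exact: grid1.
  by rewrite (telescope_sumr (fun i => (1 - grid s s' m i)^-1))// grid0 grid_last.
- by rewrite grid0 (le_trans t0).
- by move=> i; exact: grid_lt.
- move=> i im; rewrite invr_gt0 sqrtr_gt0 mulr_gt0// subr_gt0 grid1//.
  exact: leqW.
- by rewrite grid0.
Qed.

(** * The normalised bridge on a grid *)

(** [1 - k / (n + 1)] is the fraction of time left at step [k]; the standard
    bridge decays in mean proportionally to it. *)
Definition bridge_slope (n k : nat) : R :=
  (1 - k.+1%:R / n.+1%:R) / (1 - k%:R / n.+1%:R).

Definition bridge_noise (n k : nat) : R := Num.sqrt (bridge_slope n k / n.+1%:R).

(** Removing the mean and dividing by [sqrt (1 - t)] leaves a chain whose law
    depends neither on [t] nor on [x]. *)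
Definition bridge_chain (n k : nat) (w : Omega) : R :=
  (X (grid t 1 n k) w - (1 - k%:R / n.+1%:R) * x) / Num.sqrt (1 - t).

Lemma frac_lt1 n k : (k <= n)%N -> k%:R / n.+1%:R < 1 :> R.
Proof. by move=> kn; rewrite ltr_pdivrMr// mul1r ltr_nat ltnS. Qed.

Lemma bridge_slope_ge0 n k : (k < n)%N -> 0 <= bridge_slope n k <= 1.
Proof.
move=> kn; have k1 := frac_lt1 kn; have k0 := frac_lt1 (ltnW kn).
rewrite /bridge_slope divr_ge0 ?subr_ge0 ?(ltW k0) ?(ltW k1)//= ler_pdivrMr ?subr_gt0// mul1r.
by rewrite lerD2l lerN2 ler_wpM2r// ler_nat.
Qed.

Lemma bridge_chainP n : gaussian_chain P n
  (fun k => augmented_filtration W (grid t 1 n k))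
  (bridge_slope n) (bridge_noise n) (bridge_chain n).
Proof.
have sig0 : 0 < Num.sqrt (1 - t) by rewrite sqrtr_gt0 subr_gt0.
have tg k : t <= grid t 1 n k.
  by rewrite -{1}(grid0 t 1 n) grid_homo.
have g1 k : (k <= n)%N -> grid t 1 n k < 1.
  move=> kn; rewrite -[ltRHS](grid_last t 1 n).
  by apply: (le_lt_trans (grid_homo n t1 kn)); exact: grid_lt.
have one_sub k : 1 - grid t 1 n k = (1 - t) * (1 - k%:R / n.+1%:R) by rewrite /grid; ring.
split.
- by move=> k; exact: augmented_sigma_algebra.
- by move=> k; exact: augmented_sub.
- by move=> k kn; apply: augmented_le; apply/ltW/grid_lt.
- move=> k kn; have sF := augmented_sigma_algebra W (grid t 1 n k).
  apply/(fmeasP _ sF); apply: measurable_funM => //; apply: measurable_funB => //.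
  by apply/(fmeasP _ sF); apply: (bb_adapted hX) => //; exact/ltW/g1.
move=> k kn A B FA mB.
set s := grid t 1 n k in FA *; set s' := grid t 1 n k.+1.
have ss : s < s' by exact: grid_lt.
have s'1 : s' < 1 by exact: g1.
have s1 : s < 1 by exact: lt_trans s'1.
pose c := (1 - s') / Num.sqrt (1 - t).
have c0 : 0 < c by rewrite divr_gt0// subr_gt0.
have p'0 : (0 : R) < 1 - k.+1%:R / n.+1%:R by rewrite subr_gt0; exact: (frac_lt1 kn).
have p0 : (0 : R) < 1 - k%:R / n.+1%:R by rewrite subr_gt0; exact: (frac_lt1 (ltnW kn)).
have q0 : 0 < 1 - t by rewrite subr_gt0.
have E w : bridge_chain n k.+1 w - bridge_slope n k * bridge_chain n k w =
    c * (X s' w / (1 - s') - X s w / (1 - s)).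
  rewrite /bridge_chain -/s -/s' /bridge_slope /c !one_sub.
  move: p0 p'0 q0 sig0; move: (1 - k%:R / _) (1 - k.+1%:R / _) (1 - t) (Num.sqrt _).
  move=> p p' q sig /lt0r_neq0 p0 /lt0r_neq0 p'0 /lt0r_neq0 q0 /lt0r_neq0 sig0.
  by field; rewrite p0 ?p'0 q0 sig0.
under eq_set do rewrite E.
have mcB : measurable [set y : R | B (c * y)].
  by rewrite -[X in measurable X]setTI; apply: (measurable_funM (f := cst c)) => //.
rewrite (bridge_increment_law (tg k) ss s'1 FA mcB); congr (_ * normal_prob _ _ _)%E.
have -> : bridge_noise n k = c * Num.sqrt ((1 - s')^-1 - (1 - s)^-1); last first.
  by apply/seteqP; split => y /=; rewrite mulrA.
have v0 : 0 <= (1 - s')^-1 - (1 - s)^-1.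
  by rewrite subr_ge0 lef_pV2 ?posrE ?subr_gt0// lerD2l lerN2 ltW.
rewrite -{1}(gtr0_norm c0) -sqrtr_sqr -sqrtrM ?sqr_ge0//; congr Num.sqrt.
rewrite /c exprMn exprVn sqr_sqrtr ?subr_ge0 1?ltW// !one_sub /bridge_slope.
have nE : n.+1%:R^-1 = (1 - k%:R / n.+1%:R) - (1 - k.+1%:R / n.+1%:R) :> R.
  transitivity (k.+1%:R / n.+1%:R - k%:R / n.+1%:R : R); last by ring.
  by rewrite -mulrBl -natrB// subSnn mul1r.
move: p0 p'0 q0 nE.
move: (n.+1%:R^-1) (1 - k%:R / _) (1 - k.+1%:R / _) (1 - t) => N p p' q.
move=> /lt0r_neq0 p0 /lt0r_neq0 p'0 /lt0r_neq0 q0 ->.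
by field; rewrite p0 p'0 q0.
Qed.

End BridgeLaw.

(** * The running supremum of Brownian motion *)

Section Walk.
Context {R : realType} {d : measure_display} {Omega : measurableType d}.
Variables (P : probability Omega R) (W : R -> {RV P >-> R}).
Hypothesis hW : standard_brownian_motion W.

Definition walk (n k : nat) (w : Omega) : R := W (k%:R / n.+1%:R) w.

Lemma walk_chainP n : gaussian_chain P n
  (fun k => natural_filtration W (k%:R / n.+1%:R))
  (fun=> 1) (fun=> Num.sqrt (n.+1%:R^-1)) (walk n).
Proof.
have r0 k : 0 <= k%:R / n.+1%:R :> R by rewrite divr_ge0.
have rS k : k.+1%:R / n.+1%:R - k%:R / n.+1%:R = n.+1%:R^-1 :> R.
  by rewrite -mulrBl -natrB// subSnn mul1r.
have rlt k : k%:R / n.+1%:R < k.+1%:R / n.+1%:R :> R.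
  by rewrite -subr_gt0 rS invr_gt0.
split.
- by move=> k; exact: natural_sigma_algebra.
- by move=> k; exact: natural_sub.
- by move=> k _; apply: natural_le; exact: ltW.
- by move=> k _; exact: natural_fmeas.
move=> k _ A B FA mB; rewrite -(rS k) -(increment_law hW)//.
by congr (P (_ `&` _)); apply/seteqP; split => w /=; rewrite mul1r.
Qed.

End Walk.

Section AlmostEverywhereLimits.
Context {R : realType} {d : measure_display} {Omega : measurableType d}.
Variable P : probability Omega R.
Hypothesis hP : measure_is_complete P.

(** Fatou's lemma for almost sure limits; completeness of the measure makes
    the limit measurable. *)
Lemma ae_fatou (f_ : nat -> Omega -> R) (f : Omega -> R) (K : \bar R) :
  (forall n, measurable_fun setT (f_ n)) -> (forall n w, 0 <= f_ n w) ->
  (forall w, 0 <= f w) -> {ae P, forall w, f_ n w @[n --> \oo] --> f w} ->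
  (forall n, \int[P]_w (f_ n w)%:E <= K)%E ->
  measurable_fun setT (fun w => (f w)%:E) /\ (\int[P]_w (f w)%:E <= K)%E.
Proof.
move=> mf f_0 f0 fcv fK.
pose g w := limn_esup (fun n => (f_ n w)%:E).
pose g' w := limn_einf (fun n => (f_ n w)%:E).
have cvE : {ae P, forall w, (g w = (f w)%:E) /\ (g' w = (f w)%:E)}.
  move: fcv; apply: filterS => w cw.
  have : (f_ n w)%:E @[n --> \oo] --> (f w)%:E by apply/cvg_EFin => //; exact: nearW.
  by move=> /cvg_limn_einf_sup[h1 h2].
have mg : measurable_fun setT g.
  by apply: measurable_fun_limn_esup => n; exact/measurable_EFinP.
have mf' : measurable_fun setT (fun w => (f w)%:E).
  by apply: (ae_measurable_fun hP _ mg); move: cvE; apply: filterS => w [].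
split => //.
have mg' : measurable_fun setT g'.
  by apply: (ae_measurable_fun hP _ mf'); move: cvE; apply: filterS => w [].
have g'0 w : (0 <= g' w)%E.
  rewrite /g' limn_einf_lim; apply: lime_ge; first exact: is_cvg_einfs.
  apply: nearW => n; apply: le_ereal_inf_tmp => _ [m _ <-].
  by rewrite lee_fin.
apply: (@le_trans _ _ (\int[P]_w g' w)%E).
  rewrite le_eqVlt; apply/orP; left; apply/eqP; apply: ge0_ae_eq_integral => //.
  - by move=> w _; rewrite lee_fin.
  - by move: cvE; apply: filterS => w [].
have mfn n : measurable_fun setT (fun w => (f_ n w)%:E) by exact/measurable_EFinP.
have f_0' n w : setT w -> (0 <= (f_ n w)%:E)%E by rewrite lee_fin.
apply: le_trans (fatou P measurableT mfn f_0') _.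
rewrite limn_einf_lim; apply: lime_le; first exact: is_cvg_einfs.
apply: nearW => n; apply: le_trans (fK n).
by apply: ereal_inf_lbound; exists n => /=.
Qed.

End AlmostEverywhereLimits.

Section RunningSup.
Context {R : realType} {d : measure_display} {Omega : measurableType d}.
Implicit Types (Z : nat -> Omega -> R).

Lemma running_max_ge Z k i w : (i < k)%N -> `|Z i w| <= running_max Z k w.
Proof.
elim: k => [//|k IH]; rewrite ltnS leq_eqVlt => /orP[/eqP->|/IH h] /=.
  by rewrite le_max lexx orbT.
by rewrite le_max h.
Qed.

Lemma running_max_le Z k c w : 0 <= c -> (forall i, (i < k)%N -> `|Z i w| <= c) ->
  running_max Z k w <= c.
Proof.
move=> c0; elim: k => [//|k IH] h /=; rewrite ge_max h// andbT.
by apply: IH => i ik; apply: h; exact: ltnW.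
Qed.

Lemma running_max_ge0 Z k w : 0 <= running_max Z k w.
Proof. by elim: k => [//|k IH] /=; rewrite le_max IH. Qed.

Variables (P : probability Omega R) (W : R -> {RV P >-> R}).

Lemma running_sup_ge0 w : 0 <= running_sup W w.
Proof.
rewrite /running_sup; have [hs|hs] := pselect (has_sup [set `|W s w| | s in `[0, 1]]).
  apply: (le_trans (normr_ge0 (W 0 w))); apply: (sup_upper_bound hs).
  by exists 0 => //; rewrite /= in_itv /= lexx ler01.
by rewrite sup_out.
Qed.

Let c01 : `[(0:R), 1]%classic !=set0.
Proof. by exists 0; rewrite /= in_itv /= lexx ler01. Qed.

Let sub01 : `[(0:R), 1]%classic `<=` `[0, +oo[.
Proof. by move=> r /=; rewrite !in_itv /= andbT => /andP[]. Qed.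

Lemma running_sup_attained w : {within `[0, +oo[, continuous (fun t => W t w)} ->
  exists2 c, c \in `[0, 1] & running_sup W w = `|W c w| /\
    forall s, s \in `[0, 1] -> `|W s w| <= `|W c w|.
Proof.
move=> cW.
have cN : {within `[0, 1], continuous (fun t => `|W t w|)}.
  apply/subspace_continuousP => r r01; apply: cvg_norm.
  by move/(continuous_subspaceW sub01)/subspace_continuousP : cW; exact.
have [c] := compact_EVT_max c01 (@segment_compact R 0 1) cN.
rewrite inE => c1 cmax; exists c => //; split; last first.
  by move=> s s01; apply: cmax; rewrite inE.
apply/eqP; rewrite eq_le; apply/andP; split.
  apply: ge_sup; first by exists `|W c w|; exists c.
  by move=> _ [s s01 <-]; apply: cmax; rewrite inE.
apply: ub_le_sup; last by exists c.
by exists `|W c w| => _ [s s01 <-]; apply: cmax; rewrite inE.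
Qed.

Lemma running_max_le_sup n w : {within `[0, +oo[, continuous (fun t => W t w)} ->
  running_max (walk W n) n.+1 w <= running_sup W w.
Proof.
move=> /running_sup_attained[c _ [-> cmax]]; apply: running_max_le => // i.
rewrite ltnS => ni; apply: cmax; rewrite in_itv /= divr_ge0//=.
by apply/ltW/frac_lt1.
Qed.

(** The supremum is attained at some [c], and by continuity nearly attained at
    grid points close to [c]. *)
Lemma cvg_running_max w : {within `[0, +oo[, continuous (fun t => W t w)} ->
  running_max (walk W n) n.+1 w @[n --> \oo] --> running_sup W w.
Proof.
move=> cW; have [c c01' [SE cmax]] := running_sup_attained cW.
apply/cvgrPdist_lt => e e0.
have cpos : `[(0:R), +oo[%classic c by apply: sub01.
have [dl dl0 Hdl] := within_continuous_eps cW cpos e0.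
near=> n.
have le_sup := running_max_le_sup n cW.
rewrite ger0_norm ?subr_ge0// SE ltrBlDr -ltrBlDl.
have [c0 c1] : 0 <= c /\ c <= 1 by move: c01'; rewrite in_itv /= => /andP[].
(* [k / (n + 1)] is within [2 / (n + 1)] of [c], and [k <= n] even if [c = 1] *)
pose k := Num.truncn (c * n%:R).
have cn0 : 0 <= c * n%:R by rewrite mulr_ge0.
have kn : (k <= n)%N.
  rewrite -(ler_nat R); apply: (@le_trans _ _ (c * n%:R)); first by rewrite truncn_le.
  by rewrite ler_piMl.
apply: lt_le_trans (running_max_ge (walk W n) w (_ : (k < n.+1)%N)); last by rewrite ltnS.
rewrite ltrBlDl -ltrBlDr.
apply: (le_lt_trans (lerB_dist _ _)); apply: Hdl.
  by rewrite /= in_itv /= andbT divr_ge0.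
have k1 : k%:R <= c * n%:R by rewrite truncn_le.
have k2 : c * n%:R < k.+1%:R by exact: truncnS_gt.
have n0 : 0 < n.+1%:R :> R by [].
rewrite -(ltr_pM2r n0) -[X in _ * X](ger0_norm (ltW n0)) -normrM mulrBl divfK ?gt_eqF//.
have big : 2 < dl * n.+1%:R.
  rewrite -ltr_pdivrMl//; near: n; exists (Num.truncn (dl^-1 * 2)) => // n /= hn.
  by apply: (lt_le_trans (truncnS_gt _)); rewrite ler_nat ltnS.
apply: le_lt_trans big; rewrite ler_norml.
move: k1 k2; rewrite -!natr1; move: (k%:R : R) (n%:R : R) => kr nr k1 k2.
by apply/andP; split; nra.
Unshelve. all: by end_near. Qed.

Hypothesis hP : measure_is_complete P.
Hypothesis hW : standard_brownian_motion W.

Lemma c2E : c2 W = (\int[P]_w (xexp (running_sup W w))%:E)%E.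
Proof. by rewrite /c2 unlock. Qed.

Let measurable_running_max n : measurable_fun setT (running_max (walk W n) n.+1).
Proof.
have ch := walk_chainP hW n.
exact: (fmeas_measurable (@gc_sub _ _ _ _ _ _ _ _ _ ch n) (fmeas_running_max ch (leqnn n))).
Qed.

Let walk_start n : {ae P, forall w, walk W n 0 w = 0}.
Proof. by move: (sbm_start hW); apply: filterS => w; rewrite /walk mul0r. Qed.

Let walk_max n : (\int[P]_w (xexp (running_max (walk W n) n.+1 w))%:E =
  emax (fun=> 1%R) (fun=> Num.sqrt (n.+1%:R^-1)%R) n 0 0 0)%E.
Proof. exact: (integral_running_max (walk_chainP hW n) (walk_start n)). Qed.

(** The grid maxima converge to the running supremum, and [emax_walk_bounded]
    bounds the means of [xexp] uniformly in the grid. *)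
Lemma c2_bounded : measurable_fun setT (fun w => (xexp (running_sup W w))%:E) /\
  (c2 W <= (8 + 8 * expR 2)%:E)%E.
Proof.
rewrite c2E; apply: (@ae_fatou _ _ _ P hP (fun n w => xexp (running_max (walk W n) n.+1 w))).
- by move=> n; exact: (measurableT_comp (@measurable_xexp R) (measurable_running_max n)).
- by move=> n w; rewrite xexp_ge0// running_max_ge0.
- by move=> w; rewrite xexp_ge0// running_sup_ge0.
- move: (sbm_continuous hW); apply: filterS => w cW.
  have cm := cvg_running_max cW.
  by apply: cvgM => //; apply: continuous_cvg => //; exact: continuous_expR.
move=> n; rewrite walk_max; apply: emax_walk_bounded.
rewrite sqr_sqrtr ?invr_ge0// ler_pdivrMr// mul1r ler_nat; exact: leqnSn.
Qed.

Lemma c2_ge0 : (0 <= c2 W)%E.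
Proof. by rewrite c2E; apply: integral_ge0 => w _; rewrite lee_fin xexp_ge0// running_sup_ge0. Qed.

Lemma c2_fin_num : c2 W \is a fin_num.
Proof.
rewrite ge0_fin_numE ?c2_ge0//.
by apply: le_lt_trans (c2_bounded).2 _; rewrite ltry.
Qed.

(** From the bridge to the walk by comparison, and from the walk to Brownian
    motion because the grid maximum is at most the running supremum. *)
Lemma emax_bridge_le_c2 n :
  (emax (bridge_slope n) (bridge_noise n) n 0 0 0 <= c2 W)%E.
Proof.
apply: (@le_trans _ _ (emax (fun=> 1%R) (fun=> Num.sqrt (n.+1%:R^-1)%R) n 0 0 0)).
  apply: emax_compare => i; rewrite add0n /= => ni; first exact: bridge_slope_ge0.
  have /andP[s0 s1] := @bridge_slope_ge0 R n i ni.
  rewrite /bridge_noise sqrtr_ge0 ler_sqrt ?invr_ge0//.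
  by rewrite ler_piMl ?invr_ge0.
rewrite -walk_max c2E; apply: ae_ge0_le_integral => //.
- by move=> w _; rewrite lee_fin xexp_ge0// running_max_ge0.
- apply/measurable_EFinP; exact: (measurableT_comp (@measurable_xexp R) (measurable_running_max n)).
- by move=> w _; rewrite lee_fin xexp_ge0// running_sup_ge0.
- exact: c2_bounded.1.
- move: (sbm_continuous hW); apply: filterS => w cW _.
  by rewrite lee_fin xexp_le ?running_max_ge0// running_max_le_sup.
Qed.

End RunningSup.

(** * Grid approximation of the value function *)

Section GridValue.
Context {R : realType}.

Definition bridge_reward (n : nat) (sig x : R) (k : nat) (z : R) : R :=
  expR ((1 - k%:R / n.+1%:R) * x + sig * z).

Definition grid_value (n : nat) (sig x : R) : \bar R :=
  bellman (bridge_slope n) (bridge_noise n) (bridge_reward n sig x) n 0 0.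

Lemma measurable_bridge_reward n sig x k :
  measurable_fun setT (bridge_reward n sig x k).
Proof. by apply: measurableT_comp => //; exact: measurable_affine. Qed.

Definition index_above (y : R) : nat := `|Num.ceil y|%N.

Lemma index_aboveP y k : 0 <= y -> (index_above y <= k)%N = (y <= k%:R).
Proof.
move=> y0; have c0 : 0 <= Num.ceil y by rewrite ceil_ge0 (lt_le_trans _ y0)// ltrN10.
by rewrite -[k%:R]/(k%:~R) -ceil_le_int -lez_nat /index_above gez0_abs.
Qed.

Lemma index_above_lt y : 0 <= y -> (index_above y)%:R < y + 1.
Proof.
move=> y0; have c0 : 0 <= Num.ceil y by rewrite ceil_ge0 (lt_le_trans _ y0)// ltrN10.
have := ceilB1_lt y; rewrite -ltrBlDr; apply: le_lt_trans.
by rewrite intrB -[in leRHS](gez0_abs c0).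
Qed.

End GridValue.

Section ValueFunction.
Context {R : realType} {d : measure_display} {Omega : measurableType d}.
Variables (P : probability Omega R) (W : R -> {RV P >-> R}).
Variable X : R -> R -> R -> Omega -> R.
Hypothesis hP : measure_is_complete P.
Hypothesis hW : standard_brownian_motion W.
Hypothesis hX : forall t x : R, 0 <= t -> t < 1 -> brownian_bridge W t x (X t x).
Variables (t x : R).
Hypotheses (t0 : 0 <= t) (t1 : t < 1).

Local Notation sig := (Num.sqrt (1 - t)).
Local Notation Z n := (bridge_chain t x (X t x) n).
Local Notation g n := (bridge_reward n sig x).

Let sig0 : 0 < sig. Proof. by rewrite sqrtr_gt0 subr_gt0. Qed.
Let hXtx := hX x t0 t1.
Let chain n := bridge_chainP hP hW t0 t1 hXtx n.

Lemma reward_bridge n kappa w : (kappa w <= n.+1)%N ->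
  reward n (Z n) (g n) kappa w = (expR (X t x (grid t 1 n (kappa w)) w))%:E.
Proof.
rewrite /reward leq_eqVlt ltnS => /orP[/eqP kn|kn].
  by rewrite kn ltnn grid_last (bb_end hXtx) expR0.
rewrite kn /bridge_reward /bridge_chain [sig * _]mulrC divfK ?gt_eqF//.
by rewrite addrC subrK.
Qed.

Lemma bridge_chain_start n : {ae P, forall w, Z n 0 w = 0}.
Proof.
move: (bridge_start t1 hXtx); apply: filterS => w Xw.
by rewrite /bridge_chain grid0 Xw mul0r subr0 mul1r subrr mul0r.
Qed.

(** A stopping time is approached from above by the first grid point after it;
    the bridge being continuous before time [1], Fatou's lemma applies. *)
Lemma stopped_reward_le tau : admissible_time W t tau ->
  ('E_P[fun w => expR (X t x (t + tau w)%R w)] <=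
   ereal_sup (range (fun n => grid_value n sig x)))%E.
Proof.
move=> [tau01 taust]; rewrite unlock.
have t1' : 0 < 1 - t by rewrite subr_gt0.
pose y n w := n.+1%:R * (tau w / (1 - t)).
have y0 n w : 0 <= y n w.
  by have /andP[h _] := tau01 w; rewrite mulr_ge0// divr_ge0// ltW.
pose kappa n w := index_above (y n w).
have kn n w : (kappa n w <= n.+1)%N.
  rewrite index_aboveP// /y ler_piMr// ler_pdivrMr// mul1r.
  by have /andP[] := tau01 w.
have kst n : stop_index n (fun k => augmented_filtration W (grid t 1 n k)) (kappa n).
  move=> k _; have tg : t <= grid t 1 n k by rewrite -{1}(grid0 t 1 n) grid_homo.
  rewrite (_ : [set _ | _] = [set w | t + tau w <= grid t 1 n k]); first exact: taust.
  apply/seteqP; split => w /=; rewrite index_aboveP// /y /grid lerD2l;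
    by rewrite [(1 - t) * _]mulrC -ler_pdivrMr// ler_pdivlMr// mulrC.
have rE n w := @reward_bridge n (kappa n) w (kn n w).
have [] // := @ae_fatou _ _ _ P hP (fun n w => expR (X t x (grid t 1 n (kappa n w)) w))
  (fun w => expR (X t x (t + tau w) w)) (ereal_sup (range (fun n => grid_value n sig x))).
- move=> n; apply/measurable_EFinP.
  have [mr _] := integral_reward_le (chain n) (@measurable_bridge_reward R n sig x)
    (fun k z => expR_ge0 _) (@bridge_chain_start n) (kst n).
  by apply: eq_measurable_fun mr => w _; exact: rE.
- move: (bb_continuous hXtx); apply: filterS => w cX.
  have /andP[tau0 tau1] := tau01 w.
  have gt n : t + tau w <= grid t 1 n (kappa n w).
    have : (kappa n w <= kappa n w)%N by [].
    rewrite {1}/kappa index_aboveP// /y /grid lerD2l.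
    by rewrite mulrC -ler_pdivlMr// ler_pdivrMr// [_ / _ * _]mulrC.
  have glt n : grid t 1 n (kappa n w) < t + tau w + (1 - t) / n.+1%:R.
    have := index_above_lt (y0 n w); rewrite -/(kappa n w) /y => h.
    have -> : t + tau w + (1 - t) / n.+1%:R =
        t + (1 - t) / n.+1%:R * (n.+1%:R * (tau w / (1 - t)) + 1).
      have : n.+1%:R != 0 :> R by rewrite pnatr_eq0.
      move: (n.+1%:R : R) (lt0r_neq0 t1') => N q0 N0.
      by field; rewrite N0 q0.
    by rewrite /grid ltrD2l mulrCA mulrC ltr_pM2l// divr_gt0.
  apply: continuous_cvg; first exact: continuous_expR.
  have [p1|p1] := leP 1 (t + tau w).
    have pE : t + tau w = 1.
      by apply/eqP; rewrite eq_le p1 andbT -lerBrDl.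
    apply: cvg_near_cst; apply: nearW => n; congr (X t x _ w).
    apply/eqP; rewrite eq_le gt andbT pE.
    by have := grid_homo n t1 (kn n w); rewrite grid_last.
  apply/cvgrPdist_lt => e e0.
  have pin : `[t, 1[%classic (t + tau w) by rewrite /= in_itv /= p1 lerDl tau0.
  have [dl dl0 Hdl] := within_continuous_eps cX pin e0.
  near=> n.
  have small : (1 - t) / n.+1%:R < Num.min dl (1 - (t + tau w)).
    have m0 : 0 < Num.min dl (1 - (t + tau w)) by rewrite lt_min dl0 subr_gt0.
    rewrite ltr_pdivrMr// -ltr_pdivrMl//.
    near: n; exists (Num.truncn ((Num.min dl (1 - (t + tau w)))^-1 * (1 - t))) => // n /= hn.
    by apply: (lt_le_trans (truncnS_gt _)); rewrite ler_nat ltnS.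
  move: small; rewrite lt_min => /andP[s1 s2].
  apply: Hdl.
    rewrite /= in_itv /= (le_trans _ (gt n)) ?lerDl//=.
    by apply: (lt_trans (glt n)); rewrite -ltrBrDl.
  rewrite distrC ger0_norm ?subr_ge0// ltrBlDl.
  by apply: (lt_trans (glt n)); rewrite ltrD2l.
move=> n.
have [_] := integral_reward_le (chain n) (@measurable_bridge_reward R n sig x)
    (fun k z => expR_ge0 _) (@bridge_chain_start n) (kst n).
under eq_integral do rewrite rE.
by move=> /le_trans; apply; apply: ereal_sup_ubound; exists n.
Unshelve. all: by end_near. Qed.

End ValueFunction.

Section GridValueBounds.
Context {R : realType}.
Implicit Types (x sig : R).

(** The tangent inequality [exp u - exp v <= exp u * (u - v)], and
    [u <= |x| + |z|] because [sig1 <= 1]. *)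
Lemma bridge_reward_le n sig1 sig2 x k (z : R) :
  0 <= sig1 <= 1 -> (k <= n)%N ->
  bridge_reward n sig1 x k z <= bridge_reward n sig2 x k z +
    expR `|x| * `|sig1 - sig2| * xexp `|z|.
Proof.
move=> /andP[s0 s1] kn; rewrite /bridge_reward.
have r1 : k%:R / n.+1%:R < 1 :> R by exact: frac_lt1.
have r0 : 0 <= k%:R / n.+1%:R :> R by rewrite divr_ge0.
move: (k%:R / n.+1%:R) r0 r1 => r r0 r1.
set u := _ + sig1 * z; set v := _ + sig2 * z.
have tangent : expR u * (1 + (v - u)) <= expR v.
  have -> : expR v = expR u * expR (v - u) by rewrite -expRD addrC subrK.
  by rewrite ler_wpM2l ?expR_ge0// expR_ge1Dx.
have uv : u - v <= `|sig1 - sig2| * `|z|.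
  rewrite -normrM; apply: le_trans (ler_norm _).
  by rewrite /u /v le_eqVlt; apply/orP; left; apply/eqP; ring.
have ub : expR u <= expR `|x| * expR `|z|.
  rewrite -expRD ler_expR; apply: (le_trans (ler_norm _)).
  apply: (le_trans (ler_normD _ _)); rewrite !normrM; apply: lerD.
    by rewrite ler_piMl// ler_norml; apply/andP; split; lra.
  by rewrite ler_piMl// ger0_norm.
have z0 : 0 <= `|sig1 - sig2| * `|z| by rewrite mulr_ge0.
rewrite -lerBlDl; apply: (@le_trans _ _ (expR u * (u - v))); first by lra.
apply: (@le_trans _ _ (expR u * (`|sig1 - sig2| * `|z|))).
  by rewrite ler_wpM2l ?expR_ge0.
apply: le_trans (ler_wpM2r z0 ub) _.
by rewrite /xexp le_eqVlt; apply/orP; left; apply/eqP; ring.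
Qed.

Lemma grid_value_lipschitz n sig1 sig2 x : 0 <= sig1 <= 1 ->
  (grid_value n sig1 x <= grid_value n sig2 x +
    (expR `|x| * `|sig1 - sig2|)%:E *
      emax (bridge_slope n) (bridge_noise n) n 0 0 0)%E.
Proof.
move=> s1; apply: bellman_lipschitz.
- by rewrite mulr_ge0// expR_ge0.
- by move=> k; exact: measurable_bridge_reward.
- by move=> k; exact: measurable_bridge_reward.
- by move=> k z; rewrite add0n; exact: bridge_reward_le.
Qed.

Lemma grid_value0_le n x (K : R) : 1 <= K -> expR x <= K ->
  (grid_value n 0 x <= K%:E)%E.
Proof.
move=> K1 xK; apply: bellman_ub => // [k|k z]; first exact: measurable_bridge_reward.
rewrite add0n => kn; rewrite /bridge_reward mul0r addr0.
have r1 : k%:R / n.+1%:R < 1 :> R by exact: frac_lt1.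
have r0 : 0 <= k%:R / n.+1%:R :> R by rewrite divr_ge0.
have [x0|x0] := leP 0 x.
  by apply: le_trans xK; rewrite ler_expR ler_piMl// lerBlDr lerDl.
have rx : (1 - k%:R / n.+1%:R) * x <= 0.
  by apply: mulr_ge0_le0; [rewrite subr_ge0 ltW|exact: ltW].
by apply: le_trans K1; rewrite -[leRHS]expR0 ler_expR.
Qed.

Lemma grid_value_ge_start n sig x : ((expR x)%:E <= grid_value n sig x)%E.
Proof.
rewrite /grid_value; case: n => [|n] /=; rewrite le_max /bridge_reward;
  by rewrite mul0r subr0 mul1r mulr0 addr0 lexx.
Qed.

Lemma grid_value_ge1 sig x : (1 <= grid_value 0 sig x)%E.
Proof. by rewrite /grid_value /= le_max lexx orbT. Qed.

End GridValueBounds.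

Section ValueFunction.
Context {R : realType} {d : measure_display} {Omega : measurableType d}.
Variables (P : probability Omega R) (W : R -> {RV P >-> R}).
Variable X : R -> R -> R -> Omega -> R.
Hypothesis hP : measure_is_complete P.
Hypothesis hW : standard_brownian_motion W.
Hypothesis hX : forall t x : R, 0 <= t -> t < 1 -> brownian_bridge W t x (X t x).

(** The optimal index of the chain becomes a stopping time of the bridge. *)
Lemma grid_value_attained t x n : 0 <= t -> t < 1 ->
  exists2 tau, admissible_time W t tau &
    'E_P[fun w => expR (X t x (t + tau w)%R w)]%E = grid_value n (Num.sqrt (1 - t)) x.
Proof.
move=> t0 t1; have t1' : 0 < 1 - t by rewrite subr_gt0.
have [kappa [kn kst kE]] := optimal_stopping (bridge_chainP hP hW t0 t1 (hX x t0 t1) n)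
  (measurable_bridge_reward n (Num.sqrt (1 - t)) x) (fun k z => expR_ge0 _)
  (bridge_chain_start hX x t0 t1 n).
exists (fun w => (1 - t) * ((kappa w)%:R / n.+1%:R)); last first.
  rewrite unlock /grid_value -kE; apply: eq_integral => w _.
  by rewrite (reward_bridge hX).
split.
  move=> w; rewrite mulr_ge0 ?divr_ge0 ?(ltW t1')//= ler_piMr ?(ltW t1')//.
  by rewrite ler_pdivrMr// mul1r ler_nat.
move=> s ts; have [s1|s1] := leP 1 s.
  rewrite (_ : [set _ | _] = setT); first exact: (sigma_setT (augmented_sigma_algebra W s)).
  apply/seteqP; split => // w _ /=; apply: le_trans s1.
  by have := grid_homo n t1 (kn w); rewrite grid_last.
pose y := n.+1%:R * ((s - t) / (1 - t)).
have y0 : 0 <= y by rewrite mulr_ge0// divr_ge0 ?subr_ge0// ltW.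
pose k := Num.truncn y.
have kn' : (k <= n)%N.
  rewrite -ltnS truncn_lt_nat// /y gtr_pMr// ltr_pdivrMr// mul1r.
  by rewrite ltrD2r.
rewrite (_ : [set _ | _] = [set w | (kappa w <= k)%N]).
  apply: (augmented_le _ (kst k kn')).
  rewrite /grid -lerBrDl [(1 - t) * _]mulrC -ler_pdivlMr// ler_pdivrMr//.
  by rewrite [_ * n.+1%:R]mulrC -/y truncn_le.
apply/seteqP; split => w /=; rewrite -lerBrDl [(1 - t) * _]mulrC -ler_pdivlMr// ler_pdivrMr//;
  by rewrite [_ * n.+1%:R]mulrC -/y truncn_ge_nat.
Qed.

Lemma value_function_grid t x : 0 <= t -> t < 1 -> value_function W X t x =
  ereal_sup (range (fun n => grid_value n (Num.sqrt (1 - t)) x)).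
Proof.
move=> t0 t1; rewrite /value_function t1; apply/eqP; rewrite eq_le; apply/andP; split.
  by apply: ge_ereal_sup => _ [tau tauP <-]; exact: (stopped_reward_le hP hW hX x t0 t1).
apply: ge_ereal_sup => _ [n _ <-].
have [tau tauP <-] := grid_value_attained x n t0 t1.
by apply: ereal_sup_ubound; exists tau.
Qed.

Let sig01 (t : R) : 0 <= t -> t < 1 -> 0 <= Num.sqrt (1 - t) <= 1.
Proof.
move=> t0 t1; rewrite sqrtr_ge0 -[leRHS]sqrtr1 ler_sqrt//.
by rewrite lerBlDr lerDl.
Qed.

Let grid_value_lip n (s1 s2 x : R) : 0 <= s1 <= 1 -> (grid_value n s1 x <=
  grid_value n s2 x + (expR `|x| * `|s1 - s2|)%:E * c2 W)%E.
Proof.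
move=> s01; apply: (le_trans (grid_value_lipschitz n s2 x s01)).
by rewrite leeD2l// lee_wpmul2l ?emax_bridge_le_c2// lee_fin mulr_ge0// expR_ge0.
Qed.

(** Both values are suprema over the same grids, and differ only through
    [sqrt (1 - t)]. *)
Lemma value_function_lipschitz t t' x : 0 <= t -> t < 1 -> 0 <= t' -> t' < 1 ->
  (value_function W X t x <= value_function W X t' x +
    (expR `|x| * `|Num.sqrt (1 - t) - Num.sqrt (1 - t')|)%:E * c2 W)%E.
Proof.
move=> t0 t1 t'0 t'1; rewrite !value_function_grid//.
apply: ge_ereal_sup => _ [n _ <-].
apply: (le_trans (grid_value_lip n (Num.sqrt (1 - t')) x (sig01 t0 t1))).
by rewrite leeD2r//; apply: ereal_sup_ubound; exists n.
Qed.

Lemma value_function_le t x (K : R) : 0 <= t -> t < 1 -> 1 <= K -> expR x <= K ->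
  (value_function W X t x <= K%:E + (expR `|x| * Num.sqrt (1 - t))%:E * c2 W)%E.
Proof.
move=> t0 t1 K1 xK; rewrite value_function_grid//.
apply: ge_ereal_sup => _ [n _ <-].
apply: (le_trans (grid_value_lip n 0 x (sig01 t0 t1))).
rewrite subr0 (ger0_norm (sqrtr_ge0 _)) leeD2r//.
exact: grid_value0_le.
Qed.

Lemma value_function_ge_start t x : 0 <= t -> t < 1 ->
  ((expR x)%:E <= value_function W X t x)%E.
Proof.
move=> t0 t1; rewrite value_function_grid//.
apply: le_trans (grid_value_ge_start 0 (Num.sqrt (1 - t)) x) _.
by apply: ereal_sup_ubound; exists 0%N.
Qed.

Lemma value_function_ge1 t x : 0 <= t -> t < 1 ->
  (1 <= value_function W X t x)%E.
Proof.
move=> t0 t1; rewrite value_function_grid//.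
apply: le_trans (grid_value_ge1 (Num.sqrt (1 - t)) x) _.
by apply: ereal_sup_ubound; exists 0%N.
Qed.

Lemma value_function_fin_num t x : 0 <= t -> t < 1 ->
  value_function W X t x \is a fin_num.
Proof.
move=> t0 t1; rewrite ge0_fin_numE; last first.
  exact: le_trans (value_function_ge1 x t0 t1).
have := value_function_le t0 t1 (_ : 1 <= expR `|x|) (_ : expR x <= expR `|x|).
rewrite -expR0 !ler_expR normr_ge0 ler_norm expR0 => /(_ isT isT) /le_lt_trans; apply.
by rewrite -(fineK (c2_fin_num hP hW)) -EFinM -EFinD ltry.
Qed.

End ValueFunction.

Section Differences.
Context {R : realType}.

Lemma sqrt_difference (T t1 t2 : R) : T < 1 -> t1 <= t2 -> t2 <= T ->
  `|Num.sqrt (1 - t1) - Num.sqrt (1 - t2)| <= (t2 - t1) / (2 * Num.sqrt (1 - T)).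
Proof.
move=> T1 t12 t2T.
have sT : 0 < Num.sqrt (1 - T) by rewrite sqrtr_gt0 subr_gt0.
have s2 : Num.sqrt (1 - T) <= Num.sqrt (1 - t2) by rewrite ler_sqrt; lra.
have s1 : Num.sqrt (1 - t2) <= Num.sqrt (1 - t1) by rewrite ler_sqrt; lra.
rewrite ger0_norm ?subr_ge0// ler_pdivlMr ?mulr_gt0//.
have -> : t2 - t1 = (Num.sqrt (1 - t1) - Num.sqrt (1 - t2)) *
    (Num.sqrt (1 - t1) + Num.sqrt (1 - t2)).
  rewrite -subr_sqr !sqr_sqrtr; lra.
by rewrite ler_wpM2l ?subr_ge0//; lra.
Qed.

End Differences.

Theorem proposition3p2 (R : realType) (d : measure_display)
    (Omega : measurableType d) (P : probability Omega R)
    (W : R -> {RV P >-> R}) (X : R -> R -> R -> Omega -> R)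
    (hP : measure_is_complete P)
    (hW : standard_brownian_motion W)
    (hX : forall t x : R, 0 <= t -> t < 1 -> brownian_bridge W t x (X t x)) :
  [/\ (c2 W \is a fin_num) /\
      (forall T t1 t2 : R, T < 1 -> 0 <= t1 -> t1 < t2 -> t2 <= T ->
       forall x : R,
       (`|value_function W X t2 x - value_function W X t1 x| <=
        c2 W * (expR `|x| / (2 * Num.sqrt (1 - T)))%:E * (t2 - t1)%:E)%E),
      (forall x : R, 0 <= x ->
       value_function W X t x @[t --> (1 : R)^'-] --> (expR x)%:E) &
      (forall x : R, x < 0 ->
       (1%:E <= limf_einf (fun t => value_function W X t x) ((1 : R)^'-))%E /\
       expR x < 1)].
Proof.
have c2fin := c2_fin_num hP hW; have c20 := c2_ge0 W.
have near1 : \forall t \near (1 : R)^'-, 0 <= t < 1.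
  near=> t; apply/andP; split.
    by near: t; apply: nbhs_left_ge.
  by near: t; exact: nbhs_left_lt.
split; first split => //.
- move=> T t1 t2 T1 t10 t12 t2T x.
  have t20 : 0 <= t2 by exact/ltW/(le_lt_trans t10).
  have t21 : t2 < 1 by exact: le_lt_trans T1.
  have t11 : t1 < 1 by exact: lt_trans t21.
  have := value_function_lipschitz hP hW hX x t10 t11 t20 t21.
  have := value_function_lipschitz hP hW hX x t20 t21 t10 t11.
  have := value_function_fin_num hP hW hX x t10 t11.
  have := value_function_fin_num hP hW hX x t20 t21.
  have := sqrt_difference T1 (ltW t12) t2T.
  move: c20 (value_function _ _ _ _) (value_function _ _ _ _).
  rewrite -(fineK c2fin) lee_fin; move: (fine (c2 W)) => c c0.
  move=> v2 v1 sq /fineK <- /fineK <-.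
  rewrite [`|Num.sqrt (1 - t2) - _|]distrC.
  rewrite -!EFinM -!EFinD !lee_fin => v21 v12.
  have D : expR `|x| * `|Num.sqrt (1 - t1) - Num.sqrt (1 - t2)| * c <=
      c * (expR `|x| / (2 * Num.sqrt (1 - T))) * (t2 - t1).
    have -> : c * (expR `|x| / (2 * Num.sqrt (1 - T))) * (t2 - t1) =
        expR `|x| * ((t2 - t1) / (2 * Num.sqrt (1 - T))) * c by ring.
    by rewrite ler_wpM2r// ler_wpM2l// expR_ge0.
  by rewrite ler_norml; apply/andP; split; lra.
- move=> x x0.
  have ex1 : 1 <= expR x by rewrite -expR0 ler_expR.
  pose ub (t : R) := (expR x + expR `|x| * Num.sqrt (1 - t) * fine (c2 W))%:E.
  apply: (@squeeze_cvge _ _ _ _ (cst (expR x)%:E) _ ub).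
  + near=> t; have /andP[t0 t1] : 0 <= t < 1 by near: t.
    rewrite value_function_ge_start//= /ub EFinD EFinM fineK//.
    exact: value_function_le.
  + exact: cvg_cst.
  + apply/cvg_EFin; first exact: nearW.
    rewrite -[X in _ --> X]addr0; apply: cvgD; first exact: cvg_cst.
    rewrite -(mul0r (fine (c2 W))); apply: cvgM; last exact: cvg_cst.
    rewrite -(mulr0 (expR `|x|)); apply: cvgM; first exact: cvg_cst.
    apply: cvg_at_left_filter.
    rewrite [X in _ --> X](_ : 0 = Num.sqrt (1 - 1)); last by rewrite subrr sqrtr0.
    apply: continuous_cvg; first exact: sqrt_continuous.
    by apply: cvgB; [exact: cvg_cst|exact: cvg_id].
- move=> x x0; split; last by rewrite -expR0 ltr_expR.
  rewrite limf_einfE.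
  pose V : set R := [set t | 0 <= t < 1].
  have lb : (1 <= ereal_inf ((fun t => value_function W X t x) @` V))%E.
    apply: le_ereal_inf_tmp => _ [t /= /andP[t0 t1] <-].
    exact: value_function_ge1.
  apply: (le_trans lb); apply: ereal_sup_ubound.
  by exists V.
Unshelve. all: by end_near. Qed.
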